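(* Let $\mathcal C_A$ be the class of finitely generated, recursively presentable, amenable groups, and let $\mathcal C_{WP},\mathcal C_{CF},\mathcal C_{CFI},\mathcal C_{CR},\mathcal C_{SF}\subset\mathcal C_A$ be the subclasses of those groups in $\mathcal C_A$ having, respectively, solvable Word Problem; computable Følner sets; computable Følner sets by one-to-one preimages; computable Reiter functions; subrecursive Følner function. Then $$\mathcal C_{CFI}=\mathcal C_{WP}\subsetneq\mathcal C_{CF}\subset\mathcal C_{SF}=\mathcal C_{CR}=\mathcal C_A .$$
   Context: $\mathbb N$ denotes the positive integers; $\mathbb R^+$, $\mathbb Q^+$ denote the non-negative reals and rationals. $\Gamma$ is a group generated by a finite set $X$; $\mathsf X$ is a set with a bijection $\mathsf X\to X$, $\mathbb F_{\mathsf X}$ is the free group on $\mathsf X$, and $\pi_\Gamma\colon\mathbb F_{\mathsf X}\to\Gamma$ is the induced epimorphism. $\Gamma$ is recursively presentable if there is a recursive $R\subset\mathbb F_{\mathsf X}$ whose normal closure is $\ker\pi_\Gamma$; it has solvable Word Problem if $\ker\pi_\Gamma$ is recursive. A non-empty finite $\Omega\subset\Gamma$ is an $n$-Følner set (with respect to $X$) if $|\Omega\setminus x\Omega|/|\Omega|\le n^{-1}$ for all $x\in X$. $\Gamma$ is amenable if $n$-Følner sets exist for all $n\in\mathbb N$. The Følner function is $F_{\Gamma,X}(n):=\min\{|\Omega|:\Omega\text{ an }n\text{-Følner set}\}$ ($\min\emptyset=\infty$); it is subrecursive if there is a recursive (computable, total) function $u\colon\mathbb N\to\mathbb N$ with $F_{\Gamma,X}(n)\le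 u(n)$ for all $n$. A summable non-zero function $h\colon\Gamma\to\mathbb R^+$ is $n$-invariant if $\sum_{g\in\Gamma}|h(g)-h(x^{-1}g)|\le n^{-1}\sum_{g\in\Gamma}h(g)$ for all $x\in X$. $\Gamma$ has computable Følner sets if there is an algorithm which on input $n\in\mathbb N$ outputs a finite $F\subset\mathbb F_{\mathsf X}$ such that $\pi_\Gamma(F)$ is an $n$-Følner set. It has computable Følner sets by one-to-one preimages if there is such an algorithm whose outputs moreover satisfy $|F|=|\pi_\Gamma(F)|$. It has computable Reiter functions if there is an algorithm which on input $n\in\mathbb N$ outputs a finitely supported function $f\colon\mathbb F_{\mathsf X}\to\mathbb Q^+$ whose pushforward ${\pi_\Gamma}_*(f)(g):=\sum_{\nu\in\pi_\Gamma^{-1}(g)}f(\nu)$ is $n$-invariant (in particular non-zero). These properties do not depend on the choice of the finite generating set $X$. *)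

(* Defs.v *)
From HB Require Import structures.
From Stdlib Require Cantor.
From mathcomp Require Import all_boot all_order all_algebra finmap.
From mathcomp Require Import boolp classical_sets cardinality fsbigop.

Set Implicit Arguments.
Unset Strict Implicit.
Unset Printing Implicit Defensive.

Import Order.TTheory GRing.Theory Num.Theory.

Local Open Scope nat_scope.

Definition npair (a b : nat) : nat := Cantor.to_nat (a, b).
Definition nfst (n : nat) : nat := (Cantor.of_nat n).1.
Definition nsnd (n : nat) : nat := (Cantor.of_nat n).2.

(** Kleene's partial recursive functions in unary form: functions of several
    arguments are functions of one argument through the Cantor pairing, whose
    projections replace the projection functions. *)
Inductive code : Type :=
| Zero | Succ | Fst | Snd
| Pair of code & code
| Comp of code & code
| Prec of code & code
| Mu of code.

(** [run c n y]: the partial function denoted by [c] is defined at [n] and takes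
    the value [y] there.  [Prec f g] is primitive recursion,
      [h <a, 0> = f a] and [h <a, i + 1> = g <a, <i, h <a, i>>>];
    [Mu f] sends [a] to the least [n] with [f <a, n> = 0], provided that [f] is
    defined at all [<a, m>] with [m < n]. *)
Fixpoint run (c : code) (n y : nat) : Prop :=
  match c with
  | Zero => y = 0
  | Succ => y = n.+1
  | Fst => y = nfst n
  | Snd => y = nsnd n
  | Pair f g => exists u v, [/\ run f n u, run g n v & y = npair u v]
  | Comp f g => exists2 u, run g n u & run f u y
  | Prec f g =>
      (fix rec (i z : nat) : Prop :=
         match i with
         | 0 => run f (nfst n) z
         | j.+1 => exists2 t, rec j t & run g (npair (nfst n) (npair j t)) z
         end) (nsnd n) y
  | Mu f => run f (npair n y) 0 /\
      forall m, m < y -> exists t, run f (npair n m) t.+1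
  end.

Definition recursive_fun (u : nat -> nat) : Prop :=
  exists c, forall n, run c n (u n).

(** The free group on [T] as the set of reduced words.  The letter [(a, false)]
    stands for the generator [a] and [(a, true)] for its inverse. *)
Section FreeGroup.
Variable T : choiceType.
Implicit Types (a b : T * bool) (u v w : seq (T * bool)).

Definition inv_letter a : T * bool := (a.1, ~~ a.2).

Definition reduced w : bool := sorted (fun a b => b != inv_letter a) w.

Definition push a w : seq (T * bool) :=
  if w is b :: w' then if b == inv_letter a then w' else a :: w else [:: a].

Record free_group : predArgType :=
  FreeGroup { word :> seq (T * bool); word_reduced : reduced word }.

HB.instance Definition _ := [isSub for word].
HB.instance Definition _ := [Choice of free_group by <:].

Lemma inv_letterK : involutive inv_letter.
Proof. by case=> t b; rewrite /inv_letter /= negbK. Qed.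

Lemma push_reduced a w : reduced w -> reduced (push a w).
Proof.
case: w => [//|b w] /= rw; case: ifPn => [_|nb]; last by rewrite /= nb.
exact: path_sorted rw.
Qed.

Lemma foldr_push_reduced u v : reduced v -> reduced (foldr push v u).
Proof. by elim: u => //= a u IHu rv; apply/push_reduced/IHu. Qed.

Lemma pushK a w : reduced w -> push (inv_letter a) (push a w) = w.
Proof.
case: w => [|b w] /= rw; first by rewrite inv_letterK eqxx.
case: (eqVneq b (inv_letter a)) => [bE|nb] /=; last by rewrite inv_letterK eqxx.
subst b; case: w rw => [//|d w] /= /andP[nd _].
by rewrite (negbTE nd).
Qed.

Lemma pushVK a w : reduced w -> push a (push (inv_letter a) w) = w.
Proof. by move=> rw; rewrite -{1}[a]inv_letterK pushK. Qed.

Lemma push_id a w : reduced (a :: w) -> push a w = a :: w.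
Proof. by case: w => [//|b w] /= /andP[/negbTE-> _]. Qed.

Lemma foldr_push_id u : reduced u -> foldr push [::] u = u.
Proof.
elim: u => //= a u IHu ru; rewrite IHu ?push_id //; exact: path_sorted ru.
Qed.

Lemma foldr_push_push a v w : reduced w ->
  foldr push w (push a v) = push a (foldr push w v).
Proof.
move=> rw; case: v => [//|b v] /=; case: ifPn => [/eqP->|//].
by rewrite pushVK // foldr_push_reduced.
Qed.

Lemma foldr_pushA u v w : reduced w ->
  foldr push w (foldr push v u) = foldr push (foldr push w v) u.
Proof. by move=> rw; elim: u => //= a u IHu; rewrite foldr_push_push ?IHu. Qed.

Definition inv_word u := rev (map inv_letter u).

Lemma inv_wordK : involutive inv_word.
Proof. by move=> u; rewrite /inv_word map_rev revK (mapK inv_letterK). Qed.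

Lemma inv_word_reduced u : reduced u -> reduced (inv_word u).
Proof.
rewrite /reduced /inv_word rev_sorted sorted_map; apply: sub_sorted => a b /=.
by apply: contraNneq => ->; rewrite !inv_letterK.
Qed.

Lemma foldr_push_inv u : reduced u -> foldr push u (inv_word u) = [::].
Proof.
elim: u => //= a u IHu ru; have ru' : reduced u := path_sorted ru.
rewrite /inv_word /= rev_cons foldr_rcons -(push_id ru) pushK //.
exact: IHu.
Qed.

Definition free_one : free_group := @FreeGroup [::] isT.
Definition free_mul (u v : free_group) : free_group :=
  FreeGroup (foldr_push_reduced u (word_reduced v)).
Definition free_inv (u : free_group) : free_group :=
  FreeGroup (inv_word_reduced (word_reduced u)).

Lemma free_mulA : associative free_mul.
Proof. by move=> u v w; apply/val_inj/esym/foldr_pushA/word_reduced. Qed.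

Lemma free_mul1g : left_id free_one free_mul.
Proof. by move=> u; apply/val_inj. Qed.

Lemma free_mulg1 : right_id free_one free_mul.
Proof. by move=> u; apply/val_inj/foldr_push_id/word_reduced. Qed.

Lemma free_mulVg : left_inverse free_one free_inv free_mul.
Proof. by move=> u; apply/val_inj/foldr_push_inv/word_reduced. Qed.

Lemma free_mulgV : right_inverse free_one free_inv free_mul.
Proof.
move=> u; have {1}-> : u = free_inv (free_inv u).
  by apply/val_inj; rewrite /= inv_wordK.
exact: free_mulVg.
Qed.

HB.instance Definition _ := isGroup.Build free_group
  free_mulA free_mul1g free_mulg1 free_mulVg free_mulgV.

End FreeGroup.

Definition code_seq (s : seq nat) : nat :=
  foldr (fun x c => (npair x c).+1) 0 s.

Definition code_word (k : nat) (w : free_group 'I_k) : nat :=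
  code_seq [seq npair (l.1 : 'I_k) (l.2 : bool) | l <- word w].

Definition recursive_set (k : nat) (A : set (free_group 'I_k)) : Prop :=
  exists c, forall w,
    (A w -> run c (code_word w) 1) /\ (~ A w -> run c (code_word w) 0).

(** A finite set is output as a list of its elements (in any order, possibly
    with repetitions). *)
Definition outputs_fset (k : nat) (c : code) (n : nat)
    (F : {fset free_group 'I_k}) : Prop :=
  exists s : seq (free_group 'I_k),
    F = [fset w in s]%fset /\ run c n (code_seq (map (@code_word k) s)).

(** The list [s] of triples [(w, (p, q))] describes the finitely supported
    function [\sum_s p / (q + 1) * 1_w] with values in the non-negative
    rationals. *)
Definition fun_of_seq (k : nat) (s : seq (free_group 'I_k * (nat * nat)))
    (w : free_group 'I_k) : rat :=
  (\sum_(t <- s | t.1 == w) t.2.1%:R / t.2.2.+1%:R)%R.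

Definition outputs_fun (k : nat) (c : code) (n : nat)
    (f : free_group 'I_k -> rat) : Prop :=
  exists s : seq (free_group 'I_k * (nat * nat)),
    f = fun_of_seq s /\
    run c n (code_seq [seq npair (code_word t.1) (npair t.2.1 t.2.2) | t <- s]).

Section Subgroups.
Variable G : groupType.
Local Open Scope group_scope.

Definition subgroup (H : set G) : Prop :=
  [/\ H 1, forall g h, H g -> H h -> H (g * h) & forall g, H g -> H g^-1].

Definition normal_subgroup (H : set G) : Prop :=
  subgroup H /\ forall g h, H h -> H (g * h * g^-1).

Definition generated_by (A : set G) : set G := smallest subgroup A.

Definition normal_closure (A : set G) : set G := smallest normal_subgroup A.

End Subgroups.

Section MarkedGroup.
Variables (G : groupType) (k : nat) (x : 'I_k -> G).

(** The set [X] is the range of the injective family [x], and ['I_k] is the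
    alphabet in bijection with it. *)
Definition generating : Prop :=
  injective x /\ generated_by (range x) = [set: G]%classic.

Definition proj (w : free_group 'I_k) : G :=
  (\prod_(l <- word w) (if l.2 then (x l.1)^-1 else x l.1))%g.

Definition ker_proj : set (free_group 'I_k) := [set w | proj w = 1%g]%classic.

Lemma projM (u v : free_group 'I_k) : proj (u * v)%g = (proj u * proj v)%g.
Proof.
rewrite /proj /=; move: (word u) => {}u.
elim: u => [|a u IHu]; first by rewrite big_nil mul1g.
rewrite big_cons /= -mulgA -{}IHu; case: (foldr _ _ u) => [|b w] /=.
  by rewrite big_cons.
case: eqP => [->|_]; last by rewrite big_cons.
by rewrite big_cons /=; case: a.2; rewrite /= ?mulKVg ?mulKg ?mulVKg.
Qed.

Definition recursively_presentable_wrt : Prop :=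
  exists2 R : set (free_group 'I_k),
    recursive_set R & normal_closure R = ker_proj.

Definition solvable_word_problem_wrt : Prop := recursive_set ker_proj.

Definition folner_set (n : nat) (O : {fset G}) : Prop :=
  O <> fset0 /\
  forall i, (#|` O `\` [fset x i * g | g in O]%g |%:R / #|` O|%:R
             <= n%:R^-1 :> rat)%R%fset.

Definition amenable_wrt : Prop :=
  forall n, 0 < n -> exists O, folner_set n O.

(** [None] is the value infinity. *)
Definition folner_function (n : nat) : option nat :=
  match pselect (exists m, `[< exists2 O, folner_set n O & #|` O|%fset = m >])
  with
  | left nonempty => Some (ex_minn nonempty)
  | right _ => None
  end.

Definition subrecursive_folner_wrt : Prop :=
  exists2 u, recursive_fun u &
    forall n, 0 < n -> exists2 m, folner_function n = Some m & m <= u n.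

Definition computable_folner_wrt : Prop :=
  exists c, forall n, 0 < n -> exists2 F : {fset free_group 'I_k},
    outputs_fset c n F & folner_set n [fset proj w | w in F]%fset.

Definition computable_folner_injective_wrt : Prop :=
  exists c, forall n, 0 < n -> exists F : {fset free_group 'I_k},
    [/\ outputs_fset c n F,
        folner_set n [fset proj w | w in F]%fset
      & #|` F|%fset = #|` [fset proj w | w in F]|%fset].

Local Open Scope ring_scope.

(** All the functions involved have finite support, so that the sums over [G]
    are the finite sums [\sum_(g \in A)] of [fsbigop]. *)
Definition invariant (n : nat) (h : G -> rat) : Prop :=
  [/\ finite_set [set g | h g != 0]%classic,
      forall g, 0 <= h g,
      exists g, h g != 0
    & forall i, \sum_(g \in [set: G]%classic) `|h g - h ((x i)^-1 * g)%g|
        <= n%:R^-1 * \sum_(g \in [set: G]%classic) h g].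

Definition pushforward (f : free_group 'I_k -> rat) (g : G) : rat :=
  \sum_(w \in (proj @^-1` [set g])%classic) f w.

Definition computable_reiter_wrt : Prop :=
  exists c, forall n, (0 < n)%N -> exists2 f : free_group 'I_k -> rat,
    outputs_fun c n f & invariant n (pushforward f).

End MarkedGroup.

(** A group has such a property when it has it with respect to some finite
    generating set, equivalently any: none of them depends on that set. *)
Definition for_generators
    (P : forall (G : groupType) (k : nat), ('I_k -> G) -> Prop)
    (G : groupType) : Prop :=
  exists k (x : 'I_k -> G), generating x /\ P G k x.

Definition finitely_generated (G : groupType) : Prop :=
  exists k (x : 'I_k -> G), generating x.

Definition recursively_presentable := for_generators recursively_presentable_wrt.
Definition amenable := for_generators amenable_wrt.
Definition solvable_word_problem := for_generators solvable_word_problem_wrt.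
Definition computable_folner := for_generators computable_folner_wrt.
Definition computable_folner_injective :=
  for_generators computable_folner_injective_wrt.
Definition computable_reiter := for_generators computable_reiter_wrt.
Definition subrecursive_folner := for_generators subrecursive_folner_wrt.

Definition C_A (G : groupType) : Prop :=
  [/\ finitely_generated G, recursively_presentable G & amenable G].
Definition C_WP (G : groupType) : Prop := C_A G /\ solvable_word_problem G.
Definition C_CF (G : groupType) : Prop := C_A G /\ computable_folner G.
Definition C_CFI (G : groupType) : Prop :=
  C_A G /\ computable_folner_injective G.
Definition C_CR (G : groupType) : Prop := C_A G /\ computable_reiter G.
Definition C_SF (G : groupType) : Prop := C_A G /\ subrecursive_folner G.

Definition class_sub (C D : groupType -> Prop) : Prop :=
  forall G, C G -> D G.
Definition class_eq (C D : groupType -> Prop) : Prop :=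
  forall G, C G <-> D G.
Definition class_proper (C D : groupType -> Prop) : Prop :=
  class_sub C D /\ exists G, D G /\ ~ C G.

(* Main.v *)
(** For a recursively presented group, equality of words is semidecidable.  Over an
    amenable group one can therefore search for a finite set of words together with
    proofs that each generator maps almost all of it injectively into itself.  Such
    a set may collapse in the group, but the multiplicity function of its image is
    almost invariant, and one of its level sets is a Folner set: this gives
    computable Reiter functions and a computable bound on the Folner function.  When
    the word problem is solvable, the search may moreover ask for words that are
    distinct in the group.  Conversely, if [F] is mapped injectively onto an
    [n]-Folner set and [w] has length less than [n], some [u], [v] in [F] satisfy
    [w u = v] in the group; such a pair can be found, and [w] is trivial iff [u = v].

    The group with computable Folner sets and unsolvable word problem is generated
    by a shift and two involutions inside [(int * int -> 'S_3) ><| int].  The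
    commutation of the first involution with the [d]-th translate of the second is
    seen on the diagonal [q - p = d] only, and this diagonal is erased when [d] lies
    in a semidecidable undecidable set.  Any group that is locally finite by cyclic
    has Folner sets cut out by a height bound, whose closure properties are
    semidecidable, so that one of them is found by a search. *)

Require Import Defs.
From HB Require Import structures.
From Stdlib Require Cantor.
From mathcomp Require Import all_boot all_order all_algebra all_fingroup finmap.
From mathcomp Require Import boolp classical_sets functions cardinality fsbigop.
From mathcomp Require Import zify.

Set Implicit Arguments.
Unset Strict Implicit.
Unset Printing Implicit Defensive.

Import Order.TTheory GRing.Theory Num.Theory.

Local Open Scope nat_scope.

(** * Computable functions *)

#[global] Arguments npair : simpl never.
#[global] Arguments nfst : simpl never.
#[global] Arguments nsnd : simpl never.

Lemma nfst_pair a b : nfst (npair a b) = a.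
Proof. by rewrite /nfst /npair Cantor.cancel_of_to. Qed.

Lemma nsnd_pair a b : nsnd (npair a b) = b.
Proof. by rewrite /nsnd /npair Cantor.cancel_of_to. Qed.

Lemma npair_eta n : npair (nfst n) (nsnd n) = n.
Proof. by rewrite /npair /nfst /nsnd -surjective_pairing Cantor.cancel_to_of. Qed.

Lemma leq_npairr a b : b <= npair a b.
Proof.
by have := Cantor.to_nat_non_decreasing a b; rewrite /npair; lia.
Qed.

(** * Encodings of data by natural numbers, and closure properties of computable functions *)

Class encodable (T : Type) := Encodable { enc : T -> nat; enc_inj : injective enc }.
#[export] Hint Mode encodable ! : typeclass_instances.

Lemma npair_inj a b c d : npair a b = npair c d -> a = c /\ b = d.
Proof.
by move=> e; rewrite -(nfst_pair a b) -{2}(nsnd_pair a b) e nfst_pair nsnd_pair.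
Qed.

Lemma enc_nat_inj : injective (fun n : nat => n). Proof. by []. Qed.
#[export] Instance nat_encodable : encodable nat := Encodable enc_nat_inj.

Lemma enc_bool_inj : injective nat_of_bool. Proof. by case; case. Qed.
#[export] Instance bool_encodable : encodable bool := Encodable enc_bool_inj.

#[export] Instance ord_encodable k : encodable 'I_k := Encodable (@ord_inj k).

Section Encodings.
Context {S T : Type} `{encodable S} `{encodable T}.

Lemma enc_prod_inj : injective (fun p : S * T => npair (enc p.1) (enc p.2)).
Proof.
by case=> a b [c d] /= e; have [ea eb] := npair_inj e; rewrite (enc_inj ea) (enc_inj eb).
Qed.
#[export] Instance prod_encodable : encodable (S * T) := Encodable enc_prod_inj.

Lemma enc_seq_inj : injective (fun s : seq S => code_seq (map enc s)).
Proof.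
elim=> [|a s IHs] [|b r] //= e; have [ea es] := npair_inj (succn_inj e).
by rewrite (enc_inj ea) (IHs _ es).
Qed.
#[export] Instance seq_encodable : encodable (seq S) := Encodable enc_seq_inj.

Lemma enc_option_inj : injective (fun o : option S => if o is Some a then (enc a).+1 else 0).
Proof. by case=> [a|] [b|] //= e; rewrite (enc_inj (succn_inj e)). Qed.
#[export] Instance option_encodable : encodable (option S) := Encodable enc_option_inj.

End Encodings.

Lemma enc_word_inj k : injective (@code_word k).
Proof. by move=> u v e; apply/val_inj/(enc_inj (T := seq ('I_k * bool)) e). Qed.
(** Words keep the code [code_word] of the statement, which is also the code of the underlying list.
    Hence programs for [computable] functions serve directly for [recursive_set] and
    [outputs_fset]. *)
#[export] Instance word_encodable k : encodable (free_group 'I_k) :=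
  Encodable (@enc_word_inj k).

(** The program is constrained on codes of elements only; on other numbers it may do anything. *)
Definition computable {S T : Type} `{encodable S} `{encodable T} (f : S -> T) : Prop :=
  exists c, forall s, run c (enc s) (enc (f s)).

Section Kit.
Context {S T U : Type} `{encodable S} `{encodable T} `{encodable U}.

Lemma eq_computable (f g : S -> T) : f =1 g -> computable f -> computable g.
Proof. by move=> fg [c cP]; exists c => s; rewrite -fg. Qed.

Lemma computable_id : computable (fun s : S => s).
Proof.
exists (Defs.Pair Fst Snd) => s /=.
by exists (nfst (enc s)), (nsnd (enc s)); rewrite npair_eta.
Qed.

Lemma computable_comp (f : T -> U) (g : S -> T) :
  computable f -> computable g -> computable (fun s => f (g s)).
Proof. by move=> [c cP] [d dP]; exists (Comp c d) => s; exists (enc (g s)). Qed.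

Lemma computable_const (y : T) : computable (fun _ : S => y).
Proof.
have [c cP] : exists c, forall n, run c n (enc y).
  elim: (enc y) => [|m [c cP]]; first by exists Zero.
  by exists (Comp Succ c) => n; exists m.
by exists c.
Qed.

Lemma computable_pair (f : S -> T) (g : S -> U) :
  computable f -> computable g -> computable (fun s => (f s, g s)).
Proof.
by move=> [c cP] [d dP]; exists (Defs.Pair c d) => s; exists (enc (f s)), (enc (g s)).
Qed.

Lemma computable_fst (f : S -> T * U) : computable f -> computable (fun s => (f s).1).
Proof. by move=> [c cP]; exists (Comp Fst c) => s; exists (enc (f s)); rewrite //= nfst_pair. Qed.

Lemma computable_snd (f : S -> T * U) : computable f -> computable (fun s => (f s).2).
Proof. by move=> [c cP]; exists (Comp Snd c) => s; exists (enc (f s)); rewrite //= nsnd_pair. Qed.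

Lemma computable_succ (f : S -> nat) : computable f -> computable (fun s => (f s).+1).
Proof. by move=> [c cP]; exists (Comp Succ c) => s; exists (enc (f s)). Qed.

(** A program sees only codes, so it serves any function whose values have the same codes: booleans
    as numbers, words as lists, pairs as Cantor pairs. *)
Lemma computable_recode (f : S -> T) (g : S -> U) :
  (forall s, enc (f s) = enc (g s)) -> computable f -> computable g.
Proof. by move=> fg [c cP]; exists c => s; rewrite -fg. Qed.

(** The nesting [(s, (m, value))] is that of the argument which [Prec] hands to its step. *)
Lemma computable_nat_rect (z : S -> T) (f : S -> nat -> T -> T) (n : S -> nat) :
  computable z -> computable (fun t : S * (nat * T) => f t.1 t.2.1 t.2.2) ->
  computable n -> computable (fun s => nat_rect (fun=> T) (z s) (f s) (n s)).
Proof.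
move=> [cz zP] [cf fP] [cn nP]; have [ci iP] := computable_id.
exists (Comp (Prec cz cf) (Defs.Pair ci cn)) => s.
exists (npair (enc s) (n s)); first by exists (enc s), (n s).
rewrite /= nfst_pair nsnd_pair; elim: (n s) => [|m IHm] //=.
exists (enc (nat_rect (fun=> T) (z s) (f s) m)) => //.
exact: (fP (s, (m, nat_rect (fun=> T) (z s) (f s) m))).
Qed.

End Kit.

Lemma computable_comp2 {S T U V : Type} `{encodable S} `{encodable T} `{encodable U} `{encodable
  V}
    (f : T -> U -> V) (g : S -> T) (h : S -> U) :
  computable (fun p : T * U => f p.1 p.2) -> computable g -> computable h ->
  computable (fun s => f (g s) (h s)).
Proof. by move=> cf cg ch; apply: (computable_comp cf (computable_pair cg ch)). Qed.

Lemma computable_comp3 {S T U V W : Type} `{encodable S} `{encodable T} `{encodable U}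
    `{encodable V} `{encodable W} (f : T -> U -> V -> W) (g : S -> T) (h : S -> U) (i : S -> V) :
  computable (fun p : T * (U * V) => f p.1 p.2.1 p.2.2) ->
  computable g -> computable h -> computable i ->
  computable (fun s => f (g s) (h s) (i s)).
Proof.
by move=> cf cg ch ci; apply: (computable_comp cf (computable_pair cg (computable_pair ch ci))).
Qed.

(** Hooks of [computable_step], filled in by [::=] once the corresponding closure lemmas are
    available. *)
Ltac computable_arith := fail.
Ltac computable_container := fail.
Ltac computable_list := fail.
Ltac computable_user := fail.

Ltac computable_step := cbv beta zeta; first
  [ assumption | exact computable_id | apply computable_const
  | match goal with |- computable (fun s => (_, _)) => apply computable_pair end
  | match goal with
    | |- computable (fun s => (@?f s).1) => apply (computable_fst (f := f))
    | |- computable (fun s => (@?f s).2) => apply (computable_snd (f := f))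
    | |- computable fst => exact (computable_fst computable_id)
    | |- computable snd => exact (computable_snd computable_id)
    end
  | computable_arith | computable_container | computable_list | computable_user
  | lazymatch goal with |- computable (fun s => _.+1) => apply computable_succ end
  | match goal with cf : computable ?f |- computable (fun s => ?f _) =>
      apply (computable_comp cf) end
  | match goal with |- computable (fun s => ?f _ _) =>
      apply (computable_comp2 (f := f)); [assumption | |] end
  | match goal with |- computable (fun s => ?f _ _ _) =>
      apply (computable_comp3 (f := f)); [assumption | | |] end
  | lazymatch goal with
    | |- computable (fun s => _) => fail
    | |- @computable ?S _ _ _ ?f => change (computable (fun s : S => f s))
    end ].

Ltac computability := repeat computable_step.

Lemma computable_nat_of_bool {S : Type} `{encodable S} (b : S -> bool) :
  computable b -> computable (fun s => b s : nat).
Proof. exact: computable_recode. Qed.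

Lemma computable_predn {S : Type} `{encodable S} (f : S -> nat) :
  computable f -> computable (fun s => (f s).-1).
Proof.
move=> cf; apply: (@eq_computable _ _ _ _ (fun s => nat_rect (fun=> nat) 0 (fun m _ => m) (f s))).
  by move=> s; case: (f s).
by apply: computable_nat_rect; computability.
Qed.

Lemma computable_addn {S : Type} `{encodable S} (f g : S -> nat) :
  computable f -> computable g -> computable (fun s => f s + g s).
Proof.
move=> cf cg.
apply: (@eq_computable _ _ _ _ (fun s => nat_rect (fun=> nat) (g s) (fun _ x => x.+1) (f s))).
  by move=> s; elim: (f s) => //= m ->.
by apply: computable_nat_rect; computability.
Qed.

Lemma computable_subn {S : Type} `{encodable S} (f g : S -> nat) :
  computable f -> computable g -> computable (fun s => f s - g s).
Proof.
move=> cf cg.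
apply: (@eq_computable _ _ _ _ (fun s => nat_rect (fun=> nat) (f s) (fun _ x => x.-1) (g s))).
  by move=> s; elim: (g s) => [|m /= ->]; rewrite ?subn0 ?subnS.
apply: computable_nat_rect; computability; apply: computable_predn; computability.
Qed.

Lemma computable_muln {S : Type} `{encodable S} (f g : S -> nat) :
  computable f -> computable g -> computable (fun s => f s * g s).
Proof.
move=> cf cg.
apply: (@eq_computable _ _ _ _ (fun s => nat_rect (fun=> nat) 0 (fun _ x => g s + x) (f s))).
  by move=> s; elim: (f s) => //= m ->.
apply: computable_nat_rect; computability; apply: computable_addn; computability.
Qed.

Lemma computable_if {S T : Type} `{encodable S} `{encodable T} (b : S -> bool) (f g : S -> T) :
  computable b -> computable f -> computable g -> computable (fun s => if b s then f s else g s).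
Proof.
move=> cb cf cg.
apply: (@eq_computable _ _ _ _ (fun s => nat_rect (fun=> T) (g s) (fun _ _ => f s) (b s : nat))).
  by move=> s; case: (b s).
apply: computable_nat_rect; computability; exact: computable_nat_of_bool.
Qed.

Lemma computable_eq0 {S : Type} `{encodable S} (f : S -> nat) :
  computable f -> computable (fun s => f s == 0).
Proof.
move=> cf.
apply: (@eq_computable _ _ _ _ (fun s => nat_rect (fun=> bool) true (fun _ _ => false) (f s))).
  by move=> s; case: (f s).
by apply: computable_nat_rect; computability.
Qed.

Lemma computable_leq {S : Type} `{encodable S} (f g : S -> nat) :
  computable f -> computable g -> computable (fun s => f s <= g s).
Proof. by move=> cf cg; apply/computable_eq0/computable_subn. Qed.

Lemma computable_negb {S : Type} `{encodable S} (b : S -> bool) :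
  computable b -> computable (fun s => ~~ b s).
Proof. by move=> cb; apply: computable_if; computability. Qed.

Lemma computable_andb {S : Type} `{encodable S} (a b : S -> bool) :
  computable a -> computable b -> computable (fun s => a s && b s).
Proof. by move=> ca cb; apply: computable_if; computability. Qed.

Lemma computable_orb {S : Type} `{encodable S} (a b : S -> bool) :
  computable a -> computable b -> computable (fun s => a s || b s).
Proof. by move=> ca cb; apply: computable_if; computability. Qed.

Lemma computable_eqn {S : Type} `{encodable S} (f g : S -> nat) :
  computable f -> computable g -> computable (fun s => f s == g s).
Proof.
move=> cf cg; apply: (@eq_computable _ _ _ _ (fun s => (f s <= g s) && (g s <= f s))).
  by move=> s; rewrite eqn_leq.
by apply: computable_andb; apply: computable_leq.
Qed.

Lemma computable_enc {S T : Type} `{encodable S} `{encodable T} (f : S -> T) :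
  computable f -> computable (fun s => enc (f s)).
Proof. exact: computable_recode. Qed.

Lemma computable_eq {S : Type} {T : eqType} `{encodable S} `{encodable T} (f g : S -> T) :
  computable f -> computable g -> computable (fun s => f s == g s).
Proof.
move=> cf cg; apply: (@eq_computable _ _ _ _ (fun s => enc (f s) == enc (g s))).
  by move=> s; rewrite (inj_eq (@enc_inj _ _)).
by apply: computable_eqn; apply: computable_enc.
Qed.

Ltac computable_arith ::=
  lazymatch goal with
  | |- computable (fun s => nat_rect _ _ _ _) => apply computable_nat_rect
  | |- computable (fun s => if _ then _ else _) => apply computable_if
  | |- computable (fun s => _ == _) => apply computable_eq
  | |- computable (fun s => _ <= _) => apply computable_leq
  | |- computable (fun s => ~~ _) => apply computable_negb
  | |- computable (fun s => _ && _) => apply computable_andb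
  | |- computable (fun s => _ || _) => apply computable_orb
  | |- computable (fun s => _.-1) => apply computable_predn
  | |- computable (fun s => _ + _) => apply computable_addn
  | |- computable (fun s => _ - _) => apply computable_subn
  | |- computable (fun s => _ * _) => apply computable_muln
  | |- computable (fun s => enc _) => apply computable_enc
  | |- computable (fun s => nat_of_bool _) => apply computable_nat_of_bool
  end.

Section Containers.
Context {S T U V : Type} `{encodable S} `{encodable T} `{encodable U} `{encodable V}.

Lemma computable_Some (f : S -> T) : computable f -> computable (fun s => Some (f s)).
Proof. by move=> [c cP]; exists (Comp Succ c) => s; exists (enc (f s)). Qed.

Lemma computable_match_option (o : S -> option T) (f : S -> T -> U) (g : S -> U) :
  computable o -> computable (fun t : S * T => f t.1 t.2) -> computable g ->
  computable (fun s => if o s is Some x then f s x else g s).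
Proof.
(* [x0] is a default value for the content of [o s]; if [T] is empty, only the [None] branch
   occurs. *)
move=> co cf cg; have [[x0 _]|no] := pselect (exists x : T, True); last first.
  apply: eq_computable cg => s; case: (o s) => [x|//]; by case: no; exists x.
have cd : computable (fun s => odflt x0 (o s)).
  apply: (computable_recode (f := fun s => if enc (o s) == 0 then enc x0 else (enc (o s)).-1)).
    by move=> s; case: (o s).
  by computability.
apply: (@eq_computable _ _ _ _
    (fun s => if enc (o s) == 0 then g s else f s (odflt x0 (o s)))).
  by move=> s; case: (o s).
by computability.
Qed.

Lemma computable_cons (f : S -> T) (l : S -> seq T) :
  computable f -> computable l -> computable (fun s => f s :: l s).
Proof.
move=> [c cP] [d dP]; exists (Comp Succ (Defs.Pair c d)) => s.
by exists (npair (enc (f s)) (enc (l s))) => //=; exists (enc (f s)), (enc (l s)).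
Qed.

Lemma computable_npair (f g : S -> nat) :
  computable f -> computable g -> computable (fun s => npair (f s) (g s)).
Proof.
by move=> cf cg; apply: (computable_recode (f := fun s => (f s, g s))); computability.
Qed.

Lemma computable_nfst (f : S -> nat) : computable f -> computable (fun s => nfst (f s)).
Proof. by move=> [c cP]; exists (Comp Fst c) => s; exists (f s). Qed.

Lemma computable_nsnd (f : S -> nat) : computable f -> computable (fun s => nsnd (f s)).
Proof. by move=> [c cP]; exists (Comp Snd c) => s; exists (f s). Qed.

Lemma computable_behead (l : S -> seq T) : computable l -> computable (fun s => behead (l s)).
Proof.
move=> cl; apply: (computable_recode (f := fun s => nsnd (enc (l s)).-1)).
  by move=> s; case: (l s) => [|x r] //=; rewrite nsnd_pair.
by apply: computable_nsnd; computability.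
Qed.

Lemma computable_ohead (l : S -> seq T) : computable l -> computable (fun s => ohead (l s)).
Proof.
move=> cl.
apply: (computable_recode (f := fun s => if enc (l s) == 0 then 0 else (nfst (enc (l s)).-1).+1)).
  by move=> s; case: (l s) => [|x r] //=; rewrite nfst_pair.
by computability; apply: computable_nfst; computability.
Qed.

Lemma size_leq_enc (l : seq T) : size l <= enc l.
Proof. by elim: l => //= x l IHl; rewrite ltnS (leq_trans IHl) // leq_npairr. Qed.

End Containers.

Lemma computable_match_seq {S T U : Type} `{encodable S} `{encodable T} `{encodable U}
    (l : S -> seq T) (f : S -> T -> seq T -> U) (g : S -> U) :
  computable l -> computable (fun t : S * (T * seq T) => f t.1 t.2.1 t.2.2) -> computable g ->
  computable (fun s => if l s is x :: r then f s x r else g s).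
Proof.
move=> cl cf cg.
apply: (@eq_computable _ _ _ _
    (fun s => if ohead (l s) is Some x then f s x (behead (l s)) else g s)).
  by move=> s; case: (l s).
apply: (computable_match_option (f := fun s x => f s x (behead (l s)))) => //.
  exact: computable_ohead.
apply: (computable_comp (g := fun t : S * T => (t.1, (t.2, behead (l t.1)))) cf).
by computability; apply: computable_behead; computability.
Qed.

(** The fold iterates a step that consumes one element. The code of the list bounds its length, and
    surplus iterations on the empty list change nothing. *)
Lemma computable_foldl {S T U : Type} `{encodable S} `{encodable T} `{encodable U}
     (step : S -> U -> T -> U) (z : S -> U) (l : S -> seq T) :
  computable (fun t : S * (U * T) => step t.1 t.2.1 t.2.2) -> computable z -> computable l ->
  computable (fun s => foldl (step s) (z s) (l s)).
Proof.
move=> cstep cz cl.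
pose next s (p : seq T * U) := if p.1 is x :: r then (r, step s p.2 x) else p.
apply: (@eq_computable _ _ _ _
    (fun s => (nat_rect (fun=> (seq T * U)%type) (l s, z s) (fun=> next s) (enc (l s))).2)).
  move=> s; rewrite -[nat_rect _ _ _ _]/(iter (enc (l s)) (next s) (l s, z s)).
  have: size (l s) <= enc (l s) by exact: size_leq_enc.
  move: (enc (l s)) => n.
  elim: n (l s) (z s) => [|n IHn] [|x r] y // sz; last first.
    by rewrite iterSr; apply: (IHn r (step s y x)).
  by have -> : iter n.+1 (next s) ([::], y) = ([::], y) by elim: n.+1 => //= m ->.
apply/computable_snd/computable_nat_rect; [by computability | | by computability].
apply: (computable_match_seq (f := fun (t : S * (nat * (seq T * U))) x r => (r,
  step t.1 t.2.2.2 x))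
                             (l := fun t => t.2.2.1) (g := fun t => t.2.2)).
- by computability.
- by computability.
by computability.
Qed.

Ltac computable_container ::=
  lazymatch goal with
  | |- computable (fun s => Some _) => apply computable_Some
  | |- computable (fun s => npair _ _) => apply computable_npair
  | |- computable (fun s => nfst _) => apply computable_nfst
  | |- computable (fun s => nsnd _) => apply computable_nsnd
  | |- computable (fun s => behead _) => apply computable_behead
  | |- computable (fun s => ohead _) => apply computable_ohead
  | |- computable (fun s => match _ with Some _ => _ | None => _ end) =>
      apply computable_match_option
  | |- computable (fun s => match _ with nil => _ | cons _ _ => _ end) =>
      apply computable_match_seq
  | |- computable (fun s => _ :: _) => apply computable_cons
  | |- computable (fun s => foldl _ _ _) => apply computable_foldl
  end.

Section Lists.
Context {S T U : Type} `{encodable S} `{encodable T} `{encodable U}.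

Lemma computable_catrev (l r : S -> seq T) :
  computable l -> computable r -> computable (fun s => catrev (l s) (r s)).
Proof.
move=> cl cr; apply: (@eq_computable _ _ _ _ (fun s => foldl (fun r x => x :: r) (r s) (l s))).
  by move=> s; elim: (l s) (r s) => //= x l' IHl r'; rewrite IHl.
by apply: computable_foldl; computability.
Qed.

Lemma computable_rev (l : S -> seq T) : computable l -> computable (fun s => rev (l s)).
Proof. by move=> cl; apply: computable_catrev => //; apply: computable_const. Qed.

Lemma computable_foldr (step : S -> T -> U -> U) (z : S -> U) (l : S -> seq T) :
  computable (fun t : S * (T * U) => step t.1 t.2.1 t.2.2) -> computable z -> computable l ->
  computable (fun s => foldr (step s) (z s) (l s)).
Proof.
move=> cstep cz cl.
apply: (@eq_computable _ _ _ _ (fun s => foldl (fun y x => step s x y) (z s) (rev (l s)))).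
  by move=> s; rewrite foldl_rev.
by apply: (computable_foldl (step := fun s y x => step s x y));
  [computability | | exact: computable_rev].
Qed.

End Lists.

Section Lists2.
Context {S T U : Type} `{encodable S} `{encodable T} `{encodable U}.

Lemma computable_cat (l r : S -> seq T) :
  computable l -> computable r -> computable (fun s => l s ++ r s).
Proof.
move=> cl cr; apply: (@eq_computable _ _ _ _ (fun s => foldr cons (r s) (l s))).
  by move=> s; elim: (l s) => //= x l' ->.
by apply: computable_foldr; computability.
Qed.

Lemma computable_map (f : S -> T -> U) (l : S -> seq T) :
  computable (fun t : S * T => f t.1 t.2) -> computable l ->
  computable (fun s => map (f s) (l s)).
Proof.
move=> cf cl; apply: (@eq_computable _ _ _ _ (fun s => foldr (fun x r => f s x :: r) [::] (l s))).
  by move=> s; elim: (l s) => //= x l' ->.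
by apply: computable_foldr; computability.
Qed.

Lemma computable_pmap (f : S -> T -> option U) (l : S -> seq T) :
  computable (fun t : S * T => f t.1 t.2) -> computable l ->
  computable (fun s => pmap (f s) (l s)).
Proof.
move=> cf cl.
apply: (@eq_computable _ _ _ _
    (fun s => foldr (fun x r => if f s x is Some y then y :: r else r) [::] (l s))).
  by move=> s; elim: (l s) => //= x l' ->; case: (f s x).
apply: computable_foldr; computability.
Qed.

Lemma computable_has (p : S -> T -> bool) (l : S -> seq T) :
  computable (fun t : S * T => p t.1 t.2) -> computable l ->
  computable (fun s => has (p s) (l s)).
Proof.
move=> cp cl; apply: (@eq_computable _ _ _ _ (fun s => foldr (fun x b => p s x || b) false (l
  s))).
  by move=> s; elim: (l s) => //= x l' ->.
by apply: computable_foldr; computability.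
Qed.

Lemma computable_all (p : S -> T -> bool) (l : S -> seq T) :
  computable (fun t : S * T => p t.1 t.2) -> computable l ->
  computable (fun s => all (p s) (l s)).
Proof.
move=> cp cl; apply: (@eq_computable _ _ _ _ (fun s => foldr (fun x b => p s x && b) true (l s))).
  by move=> s; elim: (l s) => //= x l' ->.
by apply: computable_foldr; computability.
Qed.

Lemma computable_count (p : S -> T -> bool) (l : S -> seq T) :
  computable (fun t : S * T => p t.1 t.2) -> computable l ->
  computable (fun s => count (p s) (l s)).
Proof.
move=> cp cl; apply: (@eq_computable _ _ _ _ (fun s => foldr (fun x n => p s x + n) 0 (l s))).
  by move=> s; elim: (l s) => //= x l' ->.
apply: computable_foldr; computability.
Qed.

Lemma computable_size (l : S -> seq T) : computable l -> computable (fun s => size (l s)).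
Proof.
move=> cl; apply: (@eq_computable _ _ _ _ (fun s => foldr (fun x n => n.+1) 0 (l s))).
  by move=> s; elim: (l s) => //= x l' ->.
by apply: computable_foldr; computability.
Qed.

Lemma computable_iota (m n : S -> nat) :
  computable m -> computable n -> computable (fun s => iota (m s) (n s)).
Proof.
move=> cm cn.
apply: (@eq_computable _ _ _ _
    (fun s => rev (nat_rect (fun=> seq nat) [::] (fun i r => m s + i :: r) (n s)))).
  move=> s; elim: (n s) => // i IHi; rewrite [nat_rect _ _ _ _]/= rev_cons IHi -cats1.
  by rewrite -[in RHS]addn1 iotaD.
by apply/computable_rev; computability.
Qed.

Lemma computable_nseq (n : S -> nat) (f : S -> T) :
  computable n -> computable f -> computable (fun s => nseq (n s) (f s)).
Proof.
move=> cn cf.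
apply: (@eq_computable _ _ _ _ (fun s => nat_rect (fun=> seq T) [::] (fun _ r => f s :: r) (n
  s))).
  by move=> s; elim: (n s) => //= i ->.
by apply: computable_nat_rect; computability.
Qed.

End Lists2.

Lemma computable_flatten {S T : Type} `{encodable S} `{encodable T} (l : S -> seq (seq T)) :
  computable l -> computable (fun s => flatten (l s)).
Proof.
move=> cl; apply: (computable_foldr (step := fun _ => cat) (z := fun _ => [::])); computability.
by apply: computable_cat; computability.
Qed.

Lemma computable_mem {S : Type} {T : eqType} `{encodable S} `{encodable T} (f : S ->
  T) (l : S -> seq T) :
  computable f -> computable l -> computable (fun s => f s \in l s).
Proof.
move=> cf cl; apply: (@eq_computable _ _ _ _ (fun s => has (fun y => y == f s) (l s))).
  by move=> s; rewrite -has_pred1; apply: eq_has => y; rewrite /= eq_sym.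
by apply: computable_has; computability.
Qed.

Lemma computable_uniq {S : Type} {T : eqType} `{encodable S} `{encodable T} (l : S -> seq T) :
  computable l -> computable (fun s => uniq (l s)).
Proof.
move=> cl; apply: (@eq_computable _ _ _ _
    (fun s => foldr (fun x r => if x \in r then r else x :: r) [::] (l s) == l s)).
  move=> s; suff -> : foldr (fun x r => if x \in r then r else x :: r) [::] (l s) = undup (l s).
    apply/eqP/idP => [<-|]; [exact: undup_uniq | exact: undup_id].
  by elim: (l s) => //= x r ->; rewrite mem_undup.
computability; apply: computable_foldr; computability; apply: computable_mem; computability.
Qed.

Ltac computable_list ::=
  lazymatch goal with
  | |- computable (fun s => _ ++ _) => apply computable_cat
  | |- computable (fun s => rev _) => apply computable_rev
  | |- computable (fun s => size _) => apply computable_size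
  | |- computable (fun s => iota _ _) => apply computable_iota
  | |- computable (fun s => nseq _ _) => apply computable_nseq
  | |- computable (fun s => flatten _) => apply computable_flatten
  | |- computable (fun s => uniq _) => apply computable_uniq
  | |- computable (fun s => foldr _ _ _) => apply computable_foldr
  | |- computable (fun s => map _ _) => apply computable_map
  | |- computable (fun s => pmap _ _) => apply computable_pmap
  | |- computable (fun s => has _ _) => apply computable_has
  | |- computable (fun s => all _ _) => apply computable_all
  | |- computable (fun s => count _ _) => apply computable_count
  | |- computable (fun s => _ \in _) => apply computable_mem
  end.

Lemma computable_fin_match {S U : Type} {T : finType} `{encodable S} `{encodable T} `{encodable U}
    (f : T -> S -> U) (g : S -> T) :
  (forall x, computable (f x)) -> computable g -> computable (fun s => f (g s) s).
Proof.
move=> cf cg; have [[s0 _]|no] := pselect (exists s : S, True); last first.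
  by exists Zero => s; case: no; exists s.
(* A finite chain of equality tests. [f (g s0) s] is only a default, since [g s] occurs in the
   enumeration. *)
apply: (@eq_computable _ _ _ _
    (fun s => foldr (fun x y => if g s == x then f x s else y) (f (g s0) s) (enum T))).
  move=> s; have := mem_enum T (g s); elim: (enum T) => //= x l IHl.
  by rewrite inE; case: eqP => [->|_ /IHl].
elim: (enum T) => [|x l IHl] /=; first exact: cf.
by have := cf x; move=> cfx; computability.
Qed.

Lemma computable_fin {S U : Type} {T : finType} `{encodable S} `{encodable T} `{encodable U}
    (f : T -> U) (g : S -> T) :
  computable g -> computable (fun s => f (g s)).
Proof. by apply: (computable_fin_match (f := fun x _ => f x)) => x; apply: computable_const. Qed.

Lemma computable_search {S : Type} `{encodable S} (p : S -> nat -> bool) :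
  computable (fun t : S * nat => p t.1 t.2) -> (forall s, exists n, p s n) ->
  exists f : S -> nat, computable f /\ forall s, p s (f s).
Proof.
move=> cp ex; exists (fun s => ex_minn (ex s)); split; last first.
  by move=> s; case: ex_minnP.
(* [Mu] looks for a value 0, the code of [false], so it is applied to the negation of [p]. *)
have [c cP] : computable (fun t : S * nat => ~~ p t.1 t.2) by computability.
exists (Mu c) => s; case: ex_minnP => n pn nmin; split; first by have := cP (s, n); rewrite /= pn.
move=> m lt_mn; exists 0; have := cP (s, m) => /=; case pm: (p s m) => //=.
by have := nmin m pm; rewrite leqNgt lt_mn.
Qed.

(** * Semidecidable relations *)

Definition enumerable (T : Type) `{encodable T} : Prop :=
  exists e : nat -> option T, computable e /\ forall x, exists n, e n = Some x.
Arguments enumerable T {_}.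

Lemma enumerable_bool : enumerable bool.
Proof.
exists (fun n => Some (n == 1)); split; first by computability.
by case; [exists 1 | exists 0].
Qed.

Lemma enumerable_ord k : enumerable 'I_k.
Proof.
exists insub; split; last by move=> i; exists (val i); rewrite valK.
apply: (computable_recode (f := fun n => if n < k then n.+1 else 0)); last by computability.
by move=> n; case: ltnP => [lt_nk|le_kn]; [rewrite insubT | rewrite insubF // ltnNge le_kn].
Qed.

Lemma enumerable_prod {S T : Type} `{encodable S} `{encodable T} :
  enumerable S -> enumerable T -> enumerable (S * T).
Proof.
move=> [e [ce eP]] [d [cd dP]].
exists (fun n => if e (nfst n) is Some x then if d (nsnd n) is Some y then Some (x, y) else None
                 else None); split; first by computability.
move=> [x y]; have [m em] := eP x; have [n dn] := dP y.
by exists (npair m n); rewrite nfst_pair nsnd_pair em dn.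
Qed.

Lemma nsnd_leq n : nsnd n <= n.
Proof. by rewrite -{2}(npair_eta n) leq_npairr. Qed.

Lemma enc_seq_nat_surj n : exists s : seq nat, enc s = n.
Proof.
elim/ltn_ind: n => -[|n] IHn; first by exists [::].
have [s es] := IHn (nsnd n) (nsnd_leq n).
by exists (nfst n :: s); rewrite -[in RHS](npair_eta n) -es.
Qed.

(** Every number codes a list of numbers, so decoding it is the identity on codes; the entries are
    then enumerated separately and the failures dropped. *)
Lemma enumerable_seq {T : Type} `{encodable T} : enumerable T -> enumerable (seq T).
Proof.
move=> [e [ce eP]]; have [decode decodeP] := choice enc_seq_nat_surj.
have cdecode : computable decode.
  by apply: (computable_recode (f := fun n => n)); [move=> n; rewrite decodeP | computability].
exists (fun n => Some (pmap e (decode n))); split; first by computability.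
move=> s; have [index indexP] := choice eP; exists (enc (map index s)).
rewrite (enc_inj (decodeP (enc (map index s)))); congr Some.
by elim: s => //= x s IHs; rewrite indexP /= IHs.
Qed.

(** The existential form of semidecidability: [n] is a certificate that can be checked. *)
Definition semidecidable {S : Type} `{encodable S} (A : S -> Prop) : Prop :=
  exists p : S -> nat -> bool, computable (fun t : S * nat => p t.1 t.2) /\
    forall s, A s <-> exists n, p s n.

Section Semidecidable.
Context {S T : Type} `{encodable S} `{encodable T}.

Lemma eq_semidecidable (A B : S -> Prop) :
  (forall s, A s <-> B s) -> semidecidable A -> semidecidable B.
Proof. by move=> AB [p [cp pP]]; exists p; split=> // s; rewrite -AB pP. Qed.

Lemma semidecidable_bool (b : S -> bool) : computable b -> semidecidable (fun s => b s).
Proof.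
by move=> cb; exists (fun s _ => b s); split=> [|s]; [computability | split=> [|[]//]; exists 0].
Qed.

Lemma semidecidable_comp (A : T -> Prop) (f : S -> T) :
  semidecidable A -> computable f -> semidecidable (fun s => A (f s)).
Proof.
by move=> [p [cp pP]] cf; exists (fun s => p (f s)); split=> [|s]; [computability | exact: pP].
Qed.

Lemma semidecidable_and (A B : S -> Prop) :
  semidecidable A -> semidecidable B -> semidecidable (fun s => A s /\ B s).
Proof.
move=> [p [cp pP]] [q [cq qP]]; exists (fun s n => p s (nfst n) && q s (nsnd n)).
split=> [|s]; first by computability.
split=> [[/pP[m pm] /qP[n qn]]|[n /andP[pn qn]]].
  by exists (npair m n); rewrite nfst_pair nsnd_pair pm.
by split; [apply/pP; exists (nfst n) | apply/qP; exists (nsnd n)].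
Qed.

Lemma semidecidable_or (A B : S -> Prop) :
  semidecidable A -> semidecidable B -> semidecidable (fun s => A s \/ B s).
Proof.
move=> [p [cp pP]] [q [cq qP]]; exists (fun s n => p s n || q s n).
split=> [|s]; first by computability.
split=> [[/pP[m pm]|/qP[n qn]]|[n /orP[pn|qn]]].
- by exists m; rewrite pm.
- by exists n; rewrite qn orbT.
- by left; apply/pP; exists n.
- by right; apply/qP; exists n.
Qed.

Lemma semidecidable_exists (A : S -> T -> Prop) :
  semidecidable (fun t : S * T => A t.1 t.2) -> enumerable T ->
  semidecidable (fun s => exists x, A s x).
Proof.
move=> [p [cp pP]] [e [ce eP]].
exists (fun s n => if e (nfst n) is Some x then p (s, x) (nsnd n) else false).
split=> [|s]; first by computability.
split=> [[x /(pP (s, x))[m pm]]|[n]].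
  by have [n en] := eP x; exists (npair n m); rewrite nfst_pair nsnd_pair en.
by case: (e _) => // x px; exists x; apply/(pP (s, x)); exists (nsnd n).
Qed.

(** Unbounded search over pairs of a candidate and a certificate for it. The candidate found is
    freed from [Some], which is a predecessor on codes. *)
Lemma semidecidable_search (A : S -> T -> Prop) :
  semidecidable (fun t : S * T => A t.1 t.2) -> enumerable T ->
  (forall s, exists x, A s x) -> exists f : S -> T, computable f /\ forall s, A s (f s).
Proof.
move=> [p [cp pP]] [e [ce eP]] exA.
pose q s n := if e (nfst n) is Some x then p (s, x) (nsnd n) else false.
have cq : computable (fun t : S * nat => q t.1 t.2) by rewrite /q; computability.
have qP s : exists n, q s n.
  have [x /(pP (s, x))[m pm]] := exA s; have [n en] := eP x.
  by exists (npair n m); rewrite /q nfst_pair nsnd_pair en.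
have [n [cn nP]] := computable_search cq qP.
have defined s : exists x, e (nfst (n s)) = Some x.
  by have := nP s; rewrite /q; case: (e _) => // x _; exists x.
have [f fP] := choice defined; exists f; split=> [|s]; last first.
  by have := nP s; rewrite /q fP => px; apply/(pP (s, f s)); exists (nsnd (n s)).
apply: (computable_recode (f := fun s => (enc (e (nfst (n s)))).-1)); last by computability.
by move=> s; rewrite fP.
Qed.

End Semidecidable.

(** The certificates of finitely many elements lie below a common bound, which serves as the
    certificate of the conjunction. *)
Lemma semidecidable_all {S : Type} {T : eqType} `{encodable S} `{encodable T}
    (A : S -> T -> Prop) (l : S -> seq T) :
  semidecidable (fun t : S * T => A t.1 t.2) -> computable l ->
  semidecidable (fun s => forall x, x \in l s -> A s x).
Proof.
move=> [p [cp pP]] cl.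
exists (fun s n => all (fun x => has (fun m => p (s, x) m) (iota 0 n)) (l s)).
split=> [|s]; first by computability.
split=> [lA|[n /allP nP] x /nP /hasP[m _ pm]]; last by apply/(pP (s, x)); exists m.
elim: (l s) lA => [|x r IHr] lA; first by exists 0.
have [n /allP nP] : exists n, all (fun x => has (fun m => p (s, x) m) (iota 0 n)) r.
  by apply: IHr => y yr; apply: lA; rewrite inE yr orbT.
have [m pm] := (pP (s, x)).1 (lA x (mem_head x r)).
exists (maxn m.+1 n); apply/allP => y; rewrite inE => /orP[/eqP->|/nP/hasP[i]].
  by apply/hasP; exists m => //; rewrite mem_iota /= leq_max ltnSn.
rewrite mem_iota /= add0n => lt_in pi; apply/hasP; exists i => //.
by rewrite mem_iota /= leq_max lt_in orbT.
Qed.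

Lemma semidecidable_has {S : Type} {T : eqType} `{encodable S} `{encodable T}
    (A : S -> T -> Prop) (l : S -> seq T) :
  semidecidable (fun t : S * T => A t.1 t.2) -> enumerable T -> computable l ->
  semidecidable (fun s => exists2 x, x \in l s & A s x).
Proof.
move=> dA eT cl; apply: (@eq_semidecidable _ _ (fun s => exists x, x \in l s /\ A s x)).
  by move=> s; split=> [[x []]|[x]]; exists x.
apply: semidecidable_exists => //; apply: semidecidable_and => //.
by apply: semidecidable_bool; computability.
Qed.

(** * An undecidable semidecidable set *)

Fixpoint program (c : code) : nat :=
  match c with
  | Zero => npair 0 0
  | Succ => npair 1 0
  | Fst => npair 2 0
  | Snd => npair 3 0
  | Defs.Pair f g => npair 4 (npair (program f) (program g))
  | Comp f g => npair 5 (npair (program f) (program g))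
  | Prec f g => npair 6 (npair (program f) (program g))
  | Mu f => npair 7 (npair (program f) 0)
  end.

(* A state is a current value with a stack of pending frames [(tag, (p, a))]:
   0: run [p] on the value;  1: the value is the left component of a pair whose
   right one is [p] at [a];  2: the value is the right component of a pair whose
   left one is [a];  3: the value is the [j]-th stage of a recursion of length
   [i] with step [p], [a = <b, <j, i>>];  4: the value is [p <b, y>] in a
   minimization, [a = <b, y>]. *)
Definition frame : Type := nat * (nat * nat).

Definition call (p : nat) : frame := (0, (p, 0)).

Definition start (p v : nat) (K : seq frame) : nat * seq frame :=
  let tag := nfst p in let l := nfst (nsnd p) in let r := nsnd (nsnd p) in
  if tag == 0 then (0, K) else if tag == 1 then (v.+1, K)
  else if tag == 2 then (nfst v, K) else if tag == 3 then (nsnd v, K)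
  else if tag == 4 then (v, [:: call l, (1, (r, v)) & K])
  else if tag == 5 then (v, [:: call r, call l & K])
  else if tag == 6 then
    (nfst v, [:: call l, (3, (r, npair (nfst v) (npair 0 (nsnd v)))) & K])
  else (npair v 0, [:: call l, (4, (l, npair v 0)) & K]).

Definition resume (t : frame) (v : nat) (K : seq frame) : nat * seq frame :=
  let tag := t.1 in let p := t.2.1 in let a := t.2.2 in
  if tag == 0 then start p v K
  else if tag == 1 then (a, [:: call p, (2, (0, v)) & K])
  else if tag == 2 then (npair a v, K)
  else if tag == 3 then
    let b := nfst a in let j := nfst (nsnd a) in let i := nsnd (nsnd a) in
    if j == i then (v, K)
    else (npair b (npair j v), [:: call p, (3, (p, npair b (npair j.+1 i))) & K])
  else
    let b := nfst a in let y := nsnd a in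
    if v == 0 then (y, K) else (npair b y.+1, [:: call p, (4, (p, npair b y.+1)) & K]).

Definition machine_step (x : nat * seq frame) : nat * seq frame :=
  match x.2 with [::] => x | t :: K => resume t x.1 K end.

Lemma computable_machine_step : computable machine_step.
Proof.
rewrite /machine_step /resume /start /call.
by computability.
Qed.

Definition reaches (x y : nat * seq frame) : Prop := exists n, iter n machine_step x = y.

Lemma reaches_trans x y z : reaches x y -> reaches y z -> reaches x z.
Proof. by move=> [m xy] [n yz]; exists (n + m); rewrite iterD xy. Qed.

Lemma reaches_step x y : reaches (machine_step x) y -> reaches x y.
Proof. by move=> [n xy]; exists n.+1; rewrite iterSr. Qed.

(** Induction on the code. The stack [K] is arbitrary, so that the induction hypotheses apply to
    subprograms run above pending frames. *)
Lemma run_reaches c n y K : run c n y -> reaches (n, call (program c) :: K) (y, K).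
Proof.
have unpair := (nfst_pair, nsnd_pair).
elim: c n y K => [||||f IHf g IHg|f IHf g IHg|f IHf g IHg|f IHf] n y K /=.
- by move=> ->; exists 1; rewrite /= /machine_step /resume /start /= ?unpair.
- by move=> ->; exists 1; rewrite /= /machine_step /resume /start /= ?unpair.
- by move=> ->; exists 1; rewrite /= /machine_step /resume /start /= ?unpair.
- by move=> ->; exists 1; rewrite /= /machine_step /resume /start /= ?unpair.
- move=> [u [v [fu gv ->]]].
  apply: reaches_step; rewrite /machine_step /resume /start /= ?unpair /=.
  apply: reaches_trans (IHf _ _ _ fu) _; apply: reaches_step => /=.
  by apply: reaches_trans (IHg _ _ _ gv) _; exists 1.
- move=> [u gu fu].
  apply: reaches_step; rewrite /machine_step /resume /start /= ?unpair /=.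
  by apply: reaches_trans (IHg _ _ _ gu) _; apply: IHf.
- move=> fgy; apply: reaches_step; rewrite /machine_step /resume /start /= ?unpair /=.
  move: fgy; set a := nfst n; set i := nsnd n; set rec := (X in X i y) => fgy.
  (* Loop invariant: once the [j]-th stage is computed, it is the current value and the frame on top
     records [j]. *)
  suff stage j z : j <= i -> rec j z ->
      reaches (a, [:: call (program f), (3, (program g, npair a (npair 0 i))) & K])
              (z, (3, (program g, npair a (npair j i))) :: K).
    apply: reaches_trans (stage i y (leqnn i) fgy) _.
    by exists 1; rewrite /= /machine_step /resume /= ?unpair eqxx.
  elim: j z => [|j IHj] z; first by move=> _; apply: IHf.
  move=> lt_ji /= [t jt gz]; apply: reaches_trans (IHj t (ltnW lt_ji) jt) _.
  apply: reaches_step; rewrite /machine_step /resume /= ?unpair ltn_eqF //.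
  exact: IHg.
- move=> [fy fm]; apply: reaches_step; rewrite /machine_step /resume /start /= ?unpair /=.
  (* Loop invariant: every [m] up to [y] is eventually tried, the values before [y] being
     nonzero. *)
  suff stage m : m <= y ->
    reaches (npair n 0, [:: call (program f), (4, (program f, npair n 0)) & K])
                        (npair n m, [:: call (program f), (4, (program f, npair n m)) & K]).
    apply: reaches_trans (stage y (leqnn y)) _; apply: reaches_trans (IHf _ _ _ fy) _.
    by exists 1; rewrite /= /machine_step /resume /= ?unpair.
  elim: m => [|m IHm lt_my]; first by exists 0.
  have [t ft] := fm m lt_my; apply: reaches_trans (IHm (ltnW lt_my)) _.
  apply: reaches_trans (IHf _ _ _ ft) _.
  by exists 1; rewrite /= /machine_step /resume /= ?unpair.
Qed.

(** The result 0 is the code of [false]: this is the diagonal set defeating every decider. *)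
Definition self_halting (d : nat) : Prop := reaches (d, [:: call d]) (0, [::]).

Lemma semidecidable_self_halting : semidecidable self_halting.
Proof.
exists (fun d n => iter n machine_step (d, [:: call d]) == (0, [::])).
split; last by move=> d; split=> [[n nP]|[n /eqP nP]]; exists n => //; apply/eqP.
have cstep := computable_machine_step.
apply: (computable_eq (f := fun t : nat * nat =>
  nat_rect (fun=> (nat * seq frame)%type) (t.1, [:: call t.1]) (fun=> machine_step) t.2)).
  by rewrite /call; computability.
by computability.
Qed.

(** Run a decider on its own number [d]. The answer [false] is the result 0, which puts [d] into the
    set; the answer [true] is the result 1, and then a deterministic machine cannot also end with
    0. *)
Lemma self_halting_undecidable : ~ computable (fun d => `[<self_halting d>]).
Proof.
case=> c cP; set d := program c; have := run_reaches [::] (cP d).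
case: asboolP => [[n dn] [m]|dN dh]; last exact: dN.
(* Halted states are fixed, so both runs can be prolonged to [m + n] steps and compared. *)
have halted i y : iter i machine_step (y, [::]) = (y, [::]) by elim: i => //= i ->.
move=> dm; have : iter (m + n) machine_step (d, [:: call d]) = (0, [::]).
  by rewrite iterD dn halted.
by rewrite addnC iterD dm halted.
Qed.

(** * Evaluation of words *)

Section Evaluation.
Variables (G : groupType) (k : nat) (x : 'I_k -> G).
Implicit Types s u v : seq ('I_k * bool).

(** The extension of [proj] to unreduced words, which are easier to enumerate and to concatenate. *)
Definition eval s : G := (\prod_(l <- s) (if l.2 then (x l.1)^-1 else x l.1))%g.

Lemma eval_nil : eval [::] = 1%g. Proof. exact: big_nil. Qed.

Lemma eval_cons l s : eval (l :: s) = ((if l.2 then (x l.1)^-1 else x l.1) * eval s)%g.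
Proof. exact: big_cons. Qed.

Lemma eval_gen i : eval [:: (i, false)] = x i. Proof. by rewrite eval_cons eval_nil mulg1. Qed.

Lemma eval_cat u v : eval (u ++ v) = (eval u * eval v)%g.
Proof. by rewrite /eval big_cat. Qed.

Lemma eval_inv s : eval (inv_word s) = ((eval s)^-1)%g.
Proof.
elim: s => [|l s IHs]; first by rewrite eval_nil invg1.
rewrite /inv_word /= rev_cons -cats1 eval_cat -/(inv_word s) IHs !eval_cons eval_nil mulg1 invgM.
by congr (_ * _)%g; case: l => i [] /=; rewrite ?invgK.
Qed.

Lemma eval_nseq n l : eval (nseq n l) = ((eval [:: l]) ^+ n)%g.
Proof. by elim: n => [|n IHn]; rewrite ?eval_nil // expgS -IHn -eval_cat. Qed.

Definition reduce s : free_group 'I_k := FreeGroup (@foldr_push_reduced _ s [::] isT).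

Lemma eval_push l s : eval (push l s) = eval (l :: s).
Proof.
case: s => [//|b s] /=; case: eqP => // ->; rewrite !eval_cons /=.
by case: l => i [] /=; rewrite ?mulKVg ?mulVKg ?mulKg.
Qed.

Lemma proj_reduce s : proj x (reduce s) = eval s.
Proof.
rewrite /proj /= -/(eval _); elim: s => //= l s IHs.
by rewrite eval_push !eval_cons IHs.
Qed.

Lemma generating_eval : generating x -> forall g, exists s, eval s = g.
Proof.
move=> [_ gen] g; have : [set: G]%classic g by [].
rewrite -gen; move: g; apply: smallest_sub; last by move=> _ [i _ <-]; exists [:: (i, false)];
  rewrite eval_gen.
split; first by exists [::]; rewrite eval_nil.
  by move=> _ _ [u <-] [v <-]; exists (u ++ v); rewrite eval_cat.
by move=> _ [u <-]; exists (inv_word u); rewrite eval_inv.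
Qed.

Lemma eval_generating : injective x -> (forall g, exists s, eval s = g) -> generating x.
Proof.
move=> injx surj; split=> //; apply/seteqP; split=> // g _ M [[M1 MM MV] xM].
have [s <-] := surj g; elim: s => [|l s IHs]; first by rewrite eval_nil.
rewrite eval_cons; apply: MM IHs.
by case: l.2; [apply: MV|]; apply: xM; exists l.1.
Qed.

Definition word_problem_re : Prop := semidecidable (fun s => eval s = 1%g).

End Evaluation.

Lemma reduce_cat k (u v : seq ('I_k * bool)) : reduce (u ++ v) = (reduce u * reduce v)%g.
Proof.
apply: val_inj; rewrite /= foldr_cat.
by rewrite foldr_pushA // foldr_push_reduced.
Qed.

Lemma reduce_word k (w : free_group 'I_k) : reduce (word w) = w.
Proof. by apply/val_inj/foldr_push_id/word_reduced. Qed.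

Lemma reduce_inv k (s : seq ('I_k * bool)) : reduce (inv_word s) = ((reduce s)^-1)%g.
Proof.
(* [reduce] is itself the evaluation of words in the free group, so [eval_inv] applies to it. *)
have gE (u : seq ('I_k * bool)) : reduce u = eval (fun i => reduce [:: (i, false)]) u.
  elim: u => [|[i b] u IHu]; first by rewrite eval_nil; apply: val_inj.
  rewrite -cat1s reduce_cat eval_cons IHu; congr (_ * _)%g => /=; case: b => //.
  by apply: val_inj.
by rewrite !gE eval_inv.
Qed.

Section ComputableWords.
Context {S : Type} `{encodable S} {k : nat}.
Implicit Types f g : S -> seq ('I_k * bool).

Lemma computable_inv_word f : computable f -> computable (fun s => inv_word (f s)).
Proof. by move=> cf; rewrite /inv_word /inv_letter; computability. Qed.

Lemma computable_reduce f : computable f -> computable (fun s => reduce (f s)).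
Proof.
move=> cf; apply: (computable_recode (f := fun s => foldr (@push _) [::] (f s))) => //.
by rewrite /push /inv_letter; computability.
Qed.

Lemma computable_word (f : S -> free_group 'I_k) :
  computable f -> computable (fun s => word (f s)).
Proof. by move=> cf; apply: computable_recode cf. Qed.

End ComputableWords.

Ltac computable_user ::=
  lazymatch goal with
  | |- computable (fun s => inv_word _) => apply computable_inv_word
  | |- computable (fun s => reduce _) => apply computable_reduce
  | |- computable (fun s => word _) => apply computable_word
  end.

Lemma enumerable_raw k : enumerable (seq ('I_k * bool)).
Proof.
by apply/enumerable_seq/enumerable_prod; [apply: enumerable_ord | apply: enumerable_bool].
Qed.

Section Substitution.
Variables (k l : nat) (u : 'I_l -> seq ('I_k * bool)).

Definition substitute (s : seq ('I_l * bool)) : seq ('I_k * bool) :=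
  flatten [seq if a.2 then inv_word (u a.1) else u a.1 | a <- s].

Lemma computable_substitute : computable substitute.
Proof.
by rewrite /substitute; computability; apply: (computable_fin u); computability.
Qed.

Lemma eval_substitute (G : groupType) (x : 'I_k -> G) (y : 'I_l -> G) s :
  (forall i, eval x (u i) = y i) -> eval x (substitute s) = eval y s.
Proof.
move=> uy; elim: s => [|a s IHs]; first by rewrite !eval_nil.
rewrite /substitute /= eval_cat -/(substitute s) IHs eval_cons.
by case: a.2; rewrite ?eval_inv uy.
Qed.

End Substitution.

(** Each new generator is a fixed word in the old ones, and substitution of these words is
    computable. *)
Lemma word_problem_re_generators (G : groupType) k l (x : 'I_k -> G) (y : 'I_l -> G) :
  generating x -> word_problem_re x -> word_problem_re y.
Proof.
move=> genx dx; have [u uy] := choice (fun i => generating_eval genx (y i)).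
apply: eq_semidecidable (semidecidable_comp dx (computable_substitute u)).
by move=> s; rewrite (eval_substitute _ uy).
Qed.

Lemma recursive_setP k (A : set (free_group 'I_k)) :
  recursive_set A -> computable (fun w => `[<A w>]).
Proof. by move=> [c cP]; exists c => w; have [? ?] := cP w; case: asboolP => /= ?; auto. Qed.

(** A certificate that [s] is trivial is a list [L] of conjugated relators or inverse relators whose
    product is [s] in the free group. It can be checked, because [R] is recursive and reduction is
    computable. *)
Lemma recursive_presentation_re (G : groupType) k (x : 'I_k -> G) :
  recursively_presentable_wrt x -> word_problem_re x.
Proof.
case=> R /recursive_setP cR defR.
pose conj (t : seq ('I_k * bool) * (seq ('I_k * bool) * bool)) :=
  t.1 ++ (if t.2.2 then inv_word t.2.1 else t.2.1) ++ inv_word t.1.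
pose certifies s L := all (fun t => `[<R (reduce t.2.1)>]) L && (reduce s == reduce (flatten (map
  conj L))).
apply: (@eq_semidecidable _ _ (fun s => exists L, certifies s L)); last first.
  apply: semidecidable_exists; last first.
    apply/enumerable_seq/enumerable_prod; first exact: enumerable_raw.
    by apply: enumerable_prod; [apply: enumerable_raw | apply: enumerable_bool].
  apply: semidecidable_bool; rewrite /certifies /conj; computability.
  by apply: (computable_comp cR); computability.
have kerR w : R w -> proj x w = 1%g.
  by move=> Rw; have : normal_closure R w by [apply: sub_gen_smallest]; rewrite defR.
move=> s; split=> [[L /andP[/allP LR /eqP sL]]|s1].
  rewrite -proj_reduce {}sL proj_reduce; elim: L LR => [|[u [r b]] L IHL] LR;
    first by rewrite eval_nil.
  rewrite /= eval_cat IHL; last by move=> t tL; apply: LR; rewrite inE tL orbT.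
  have /asboolP /kerR := LR _ (mem_head _ _); rewrite /= proj_reduce => r1.
  by rewrite /conj /= !eval_cat mulg1 eval_inv; case: (b);
    rewrite ?eval_inv r1 ?invg1 mul1g mulgV.
have : normal_closure R (reduce s) by rewrite defR /ker_proj /= proj_reduce.
(* The certified words form a normal subgroup containing [R], hence contain the normal closure. *)
pose N : set (free_group 'I_k) := [set w | exists L, certifies (word w) L]%classic.
suff NP : normal_subgroup N /\ (R `<=` N)%classic.
  move=> /(smallest_sub NP.1 NP.2) [L /andP[LR]]; rewrite reduce_word => sL.
  by exists L; rewrite /certifies LR.
split; last first.
  move=> w Rw; exists [:: ([::], (word w, false))];
    rewrite /certifies /= !reduce_word cats0 /conj /= cats0.
  by rewrite ?reduce_word ?eqxx ?andbT; apply/asboolP.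
split; [split|].
- by exists [::]; rewrite /certifies reduce_word; apply/eqP/val_inj.
- move=> v w [L /andP[LR]]; rewrite reduce_word => /eqP vL [M /andP[MR]].
  rewrite reduce_word => /eqP wM; exists (L ++ M).
  by rewrite /certifies all_cat LR MR reduce_word map_cat flatten_cat reduce_cat -vL -wM /=.
- move=> v [L /andP[/allP LR]]; rewrite reduce_word => /eqP vL.
  (* The inverse of a product of conjugates: reversed order and opposite signs, with the same
     conjugators. *)
  exists (rev [seq (t.1, (t.2.1, ~~ t.2.2)) | t <- L]); rewrite /certifies reduce_word;
    apply/andP; split.
    by apply/allP => t; rewrite mem_rev => /mapP[t' /LR ? ->].
  apply/eqP; rewrite {}vL -reduce_inv; congr reduce; elim: L {LR} => //= t L IHL.
  rewrite rev_cons map_rcons flatten_rcons -{}IHL /inv_word map_cat rev_cat; congr cat.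
  have inv_cat := (map_cat, rev_cat).
  rewrite /conj /= /inv_word !inv_cat -!/(inv_word _) inv_wordK -catA.
  by case: t.2.2; rewrite ?inv_wordK.
- move=> v w [L /andP[/allP LR]]; rewrite reduce_word => /eqP wL.
  exists [seq (word v ++ t.1, t.2) | t <- L]; rewrite /certifies reduce_word; apply/andP; split.
    by apply/allP => t /mapP[t' /LR ? ->].
  apply/eqP; rewrite {}wL; elim: L {LR} => [|t L IHL] /=.
    have -> : reduce [::] = 1%g :> free_group 'I_k by apply: val_inj.
    by rewrite mulg1 mulgV.
  rewrite !reduce_cat -{}IHL /conj /= !reduce_inv !reduce_cat reduce_word.
  by rewrite invgM !mulgA mulgVK.
Qed.

(** * Folner sets and matchings *)

Section Folner.
Variables (G : groupType).
Implicit Types (g h : G) (O : {fset G}).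
Local Open Scope fset_scope.

Definition translate g O : {fset G} := [fset (g * h)%g | h in O].

Definition boundary g O : nat := #|` O `\` translate g O|.

Lemma mem_translate g h O : (h \in translate g O) = ((g^-1 * h)%g \in O).
Proof.
apply/imfsetP/idP => [[a /= aO ->]|gO]; first by rewrite mulKg.
by exists (g^-1 * h)%g; rewrite //= mulVKg.
Qed.

Lemma card_translate g O : #|` translate g O| = #|` O|.
Proof. by rewrite card_imfset //=; apply: mulgI. Qed.

Lemma boundary1 O : boundary 1 O = 0.
Proof.
apply/eqP; rewrite cardfs_eq0 fsetD_eq0; apply/fsubsetP => h.
by rewrite mem_translate invg1 mul1g.
Qed.

(** A point of [O] outside [g h O] is either outside [g O] or in the translate by [g] of [O] minus
    [h O]. *)
Lemma boundaryM g h O : boundary (g * h) O <= boundary g O + boundary h O.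
Proof.
rewrite {3}/boundary -(card_translate g).
apply: leq_trans (fsubset_leq_card _) (leq_card_fsetU _ _).
apply/fsubsetP => a; rewrite !inE !mem_translate !inE !mem_translate invgM -mulgA.
by do 3?case: (_ \in O).
Qed.

(** Translation by [g] carries the intersection of [O] and [g^-1 O] onto that of [g O] and [O]. *)
Lemma boundaryV g O : boundary g^-1 O = boundary g O.
Proof.
rewrite /boundary !cardfsD; congr (_ - _); rewrite -(card_translate g).
congr #|` _|; apply/fsetP => a; rewrite mem_translate !inE !mem_translate invgK mulVKg.
by rewrite andbC.
Qed.

Variables (k : nat) (x : 'I_k -> G).

Lemma folner_setE n O : 0 < n ->
  folner_set x n O <-> O != fset0 /\ forall i, n * boundary (x i) O <= #|` O|.
Proof.
move=> n0; split=> [[/eqP O0 On]|[O0 On]]; split=> //; try exact/eqP.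
  move=> i; have := On i; rewrite ler_pdivrMr ?ltr0n ?cardfs_gt0 //.
  by rewrite ler_pdivlMl ?ltr0n // -natrM ler_nat.
move=> i; rewrite ler_pdivrMr ?ltr0n ?cardfs_gt0 //.
by rewrite ler_pdivlMl ?ltr0n // -natrM ler_nat; apply: On.
Qed.

Lemma boundary_eval n O s : (forall i, n * boundary (x i) O <= #|` O|) ->
  n * boundary (eval x s) O <= size s * #|` O|.
Proof.
move=> On; elim: s => [|l s IHs]; first by rewrite eval_nil boundary1 muln0.
rewrite eval_cons; apply: leq_trans (leq_mul (leqnn n) (boundaryM _ _ _)) _.
rewrite mulnDr mulSn leq_add //; case: l.2; rewrite ?boundaryV; exact: On.
Qed.

End Folner.

Lemma amenable_generators (G : groupType) k l (x : 'I_k -> G) (y : 'I_l -> G) :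
  generating x -> amenable_wrt x -> amenable_wrt y.
Proof.
move=> genx amx n n0; have [u uy] := choice (fun i => generating_eval genx (y i)).
(* [m] bounds the length of each new generator as a word in the old ones; the factor [m.+1] in the
   Folner condition pays for it. *)
pose m := \sum_i size (u i).
have nm0 : 0 < n * m.+1 by rewrite muln_gt0 n0.
have [O /(folner_setE _ _ nm0)[O0 On]] := amx _ nm0.
exists O; apply/folner_setE => //; split=> // i;
  rewrite -(leq_pmul2l (ltn0Sn m)) mulnA [m.+1 * n]mulnC -uy.
apply: leq_trans (boundary_eval _ On) _; rewrite leq_mul2r ltnW ?orbT // ltnS.
by rewrite /m (bigD1 i) //= leq_addr.
Qed.

(** * Almost invariant lists of words, certified by matchings *)

Section Matchings.
Variables (G : groupType) (k : nat) (x : 'I_k -> G).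
Notation raw := (seq ('I_k * bool)).
Implicit Types (ws : seq raw) (g : G).

(* [m] is the graph of a partial injection of [ws] into itself, undefined on at
   most a fraction [1/n] of [ws]. *)
Definition is_matching n ws (m : seq (raw * raw)) : bool :=
  [&& uniq (map fst m), uniq (map snd m), all (fun u => u \in ws) (map fst m),
      all (fun v => v \in ws) (map snd m) & n * (size ws - size m) <= size ws].

(** The words are distinct as words but may coincide in the group. All equations required are
    between elements of the group, so the condition is semidecidable as soon as the word problem
    is. *)
Definition matched n ws : Prop :=
  (uniq ws && (0 < size ws)) /\ forall i, i \in enum 'I_k ->
    exists m, is_matching n ws m /\
      forall t, t \in m -> eval x ((i, false) :: t.1) = eval x t.2.

Lemma semidecidable_eval_eq : word_problem_re x ->
  semidecidable (fun t : raw * raw => eval x t.1 = eval x t.2).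
Proof.
move=> wpx; apply: (@eq_semidecidable _ _ (fun t : raw * raw => eval x (t.1 ++ inv_word t.2) =
  1%g)).
  move=> t; rewrite eval_cat eval_inv; split=> [/divg1_eq //|->]; exact: mulgV.
by apply: (semidecidable_comp wpx (f := fun t : raw * raw => t.1 ++ inv_word t.2)); computability.
Qed.

Lemma semidecidable_matched : word_problem_re x ->
  semidecidable (fun t : nat * seq raw => matched t.1 t.2).
Proof.
move=> /semidecidable_eval_eq eqx; apply: semidecidable_and.
  by apply: semidecidable_bool; computability.
apply: semidecidable_all; last by computability.
apply: semidecidable_exists; last first.
  by apply/enumerable_seq/enumerable_prod; apply: enumerable_raw.
apply: semidecidable_and.
  by apply: semidecidable_bool; rewrite /is_matching; computability.
apply: (semidecidable_all (A := fun s t => eval x ((s.1.2,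
  false) :: t.1) = eval x t.2) (l := snd)).
  apply: (semidecidable_comp eqx (f := fun t => ((t.1.1.2, false) :: t.2.1, t.2.2))).
  by computability.
by computability.
Qed.

(** Choose one word for each element of [O]. The matching for [x i] sends the word of [(x i)^-1 * g]
    to that of [g] whenever both elements lie in [O]. *)
Lemma folner_matched n O : generating x -> 0 < n -> folner_set x n O ->
  exists2 ws, matched n ws & {in ws &, injective (eval x)}.
Proof.
move=> genx n0 /(folner_setE _ _ n0)[O0 On]; have [r rE] := choice (generating_eval genx).
have injr : injective r by apply: can_inj rE.
exists (map r O); last by move=> _ _ /mapP[g _ ->] /mapP[h _ ->]; rewrite !rE => ->.
split; first by rewrite map_inj_uniq // fset_uniq size_map cardfs_gt0.
move=> i _; pose D := (O `&` translate (x i) O)%fset.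
exists [seq (r ((x i)^-1 * g)%g, r g) | g <- D]; split; last first.
  by move=> _ /mapP[g _ ->]; rewrite eval_cons !rE mulVKg.
have DP g : g \in (D : seq G) -> g \in O /\ ((x i)^-1 * g)%g \in O.
  by rewrite inE mem_translate => /andP.
rewrite /is_matching -!map_comp map_inj_uniq; last by move=> g h /injr /mulgI.
rewrite map_inj_uniq // fset_uniq !all_map !size_map; apply/and5P; split=> //.
- by apply/allP => g /DP[_ gO]; apply: map_f.
- by apply/allP => g /DP[gO _]; apply: map_f.
- by rewrite -cardfsD; apply: On.
Qed.

(** The pushforward to the group of the counting measure on [ws]. *)
Definition mult ws g : nat := count (fun w => eval x w == g) ws.

Lemma mult_subset ws vs : uniq ws -> uniq vs -> all (fun v => v \in ws) vs ->
  exists2 ds, size ds = size ws - size vs & forall g, mult ws g = mult vs g + mult ds g.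
Proof.
move=> Uws Uvs /allP vws; exists [seq w <- ws | w \notin vs].
  have -> : size vs = count (mem vs) ws.
    rewrite -size_filter; apply/perm_size/uniq_perm => //; first exact: filter_uniq.
    by move=> w; rewrite mem_filter /=; case wvs: (w \in vs) => //=; rewrite vws.
  by rewrite size_filter -(count_predC (mem vs) ws) addKn.
move=> g; rewrite /mult; have /seq.permP <- := permEl (perm_filterC (mem vs) ws).
rewrite count_cat; congr (_ + _); apply/seq.permP/uniq_perm; rewrite ?filter_uniq // => w.
by rewrite mem_filter /=; case wvs: (w \in vs) => //=; rewrite vws.
Qed.

(** Matched pairs contribute equally to [g] and to [(x i)^-1 * g]. The rest comes from the words
    [ds] that the matching does not reach and the words [es] where it is undefined. *)
Lemma mult_matching n ws m i : uniq ws -> is_matching n ws m ->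
  (forall t, t \in m -> eval x ((i, false) :: t.1) = eval x t.2) ->
  exists ds es, [/\ size ds = size ws - size m, size es = size ws - size m &
    forall g, mult ws g + mult es ((x i)^-1 * g)%g = mult ws ((x i)^-1 * g)%g + mult ds g].
Proof.
move=> Uws /and5P[Uu Uv uws vws _] mE.
have [ds] := mult_subset Uws Uv vws; have [es] := mult_subset Uws Uu uws.
rewrite !size_map => ses esE sds dsE; exists ds, es; split=> // g; rewrite dsE esE.
suff -> : mult (map fst m) ((x i)^-1 * g)%g = mult (map snd m) g by rewrite addnAC.
rewrite /mult !count_map; apply: eq_in_count => t /mE; rewrite /= => <-.
by rewrite eval_cons /= -(inj_eq (mulgI (x i))) mulVKg.
Qed.

Lemma sum_mult (A : seq G) ws : uniq A -> \sum_(g <- A) mult ws g <= size ws.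
Proof.
move=> UA; elim: ws => [|w ws IHws]; first by rewrite big1.
rewrite /mult /= big_split /= -add1n leq_add //.
rewrite (eq_bigr (fun g => (g == eval x w) : nat)); last by move=> g _; rewrite eq_sym.
by rewrite -big_mkcond /= sum1_count count_uniq_mem // leq_b1.
Qed.

Lemma sum_mult_supp (A : seq G) ws : uniq A -> {subset map (eval x) ws <= A} ->
  \sum_(g <- A) mult ws g = size ws.
Proof.
move=> UA; elim: ws => [|w ws IHws] sA; first by rewrite big1.
rewrite /mult /= big_split /= IHws; last by move=> g gw; apply: sA; rewrite inE gw orbT.
rewrite (eq_bigr (fun g => (g == eval x w) : nat)); last by move=> g _; rewrite eq_sym.
by rewrite -big_mkcond /= sum1_count count_uniq_mem // sA ?mem_head.
Qed.

Lemma mult_gt0 ws g : (0 < mult ws g) = (g \in map (eval x) ws).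
Proof.
rewrite -has_count; apply/hasP/mapP => [[w ww /eqP <-]|[w ww ->]]; first by exists w.
by exists w.
Qed.

End Matchings.

Lemma sum_interval (a b m : nat) : b <= m -> \sum_(t < m) (a <= t < b) = b - a.
Proof.
move=> bm; rewrite -[b in RHS](minn_idPr bm); elim: m {bm} => [|m IHm].
  by rewrite big_ord0 min0n.
by rewrite big_ord_recr /= IHm; lia.
Qed.

(** * Level sets of the multiplicity function and bounds on the Folner function *)

Section Reiter.
Variables (G : groupType) (k : nat) (x : 'I_k -> G).
Notation raw := (seq ('I_k * bool)).

(** The successor keeps the parameter positive, so that the search succeeds for every [n], also for
    0. *)
Lemma matched_words (c : nat) : generating x -> word_problem_re x -> amenable_wrt x ->
  exists f : nat -> seq raw, computable f /\ forall n, matched x (c * n).+1 (f n).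
Proof.
move=> genx rex amx; apply: (semidecidable_search (A := fun n ws => matched x (c * n).+1 ws)).
- apply: (semidecidable_comp (semidecidable_matched rex) (f := fun t => ((c * t.1).+1, t.2))).
  by computability.
- exact/enumerable_seq/enumerable_raw.
- move=> n; have [O /(folner_matched genx (ltn0Sn _))[ws wsP _]] := amx _ (ltn0Sn (c * n)).
  by exists ws.
Qed.

(* The average of the boundaries of the level sets of the multiplicity function
   is at most the total defect of the matchings, so some level set is a Folner set. *)
Lemma matched_folner n ws : 0 < n -> matched x (k * n).+1 ws ->
  exists2 O, folner_set x n O & #|` O|%fset <= size ws.
Proof.
move=> n0 [/andP[Uws ws0] wsm].
pose S := undup (map (eval x) ws); have US : uniq S by apply: undup_uniq.
pose L t := [fset g in S | t < mult x ws g]%fset.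
have LP t g : (g \in L t) = (t < mult x ws g).
  rewrite !inE /= mem_undup -mult_gt0; case: (ltnP t) => [/(leq_ltn_trans (leq0n _))->//|].
  by rewrite andbF.
have mult_le g : mult x ws g <= size ws by apply: count_size.
have cardS (p : pred G) (A : {fset G}) : (forall g, (g \in A) = (g \in S) && p g) ->
    #|` A|%fset = \sum_(g <- S) p g.
  move=> Ap; rewrite -big_mkcond sum1_count -size_filter; apply: perm_size.
  by apply: uniq_perm; rewrite ?fset_uniq ?filter_uniq // => g; rewrite mem_filter andbC;
    apply: Ap.
have cardL t : #|` L t|%fset = \sum_(g <- S) (0 <= t < mult x ws g).
  by apply: cardS => g; rewrite !inE.
(* Layer-cake formula: the level sets together count each word once. *)
have sumL : \sum_(t < size ws) #|` L t|%fset = size ws.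
  under eq_bigr => t _ do rewrite cardL.
  rewrite exchange_big; under eq_bigr => g _ do rewrite sum_interval // subn0.
  by apply: sum_mult_supp => // g; rewrite mem_undup.
(* A level [t] contributes [g] to the boundary when it separates the multiplicities of
   [(x i)^-1 * g] and of [g]; their difference is at most the number of unreached words over [g]. *)
have sumD i : k * n * \sum_(t < size ws) boundary (x i) (L t) <= size ws.
  have [m [mm mE]] := wsm i (mem_enum _ i).
  have [ds [es [sds _ dsE]]] := mult_matching Uws mm mE.
  have /and5P[_ _ _ _ mn] := mm; apply: leq_trans mn.
  apply: leq_mul => //; rewrite -sds; apply: leq_trans (sum_mult x ds US).
  have cardD t : boundary (x i) (L t) =
      \sum_(g <- S) (mult x ws ((x i)^-1 * g)%g <= t < mult x ws g).
    by apply: cardS => g; rewrite in_fsetD mem_translate (LP t (_ * _)%g) -leqNgt !inE andbCA.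
  under [leqLHS]eq_bigr => t _ do rewrite cardD.
  rewrite exchange_big; apply: leq_sum => g _.
  by rewrite sum_interval // leq_subLR -dsE leq_addr.
have [t [Lt0 tP]] : exists t, L t != fset0 /\ forall i, n * boundary (x i) (L t) <= #|` L t|%fset.
  apply: contrapT => noL.
  (* A nonempty level set that is not Folner gives a strict inequality, recorded by the extra 1. As
     [L 0] is nonempty, summing over [t] exceeds the total [size ws]; the factor [k] in the matching
     condition absorbs the sum over generators. *)
  have bad (t : nat) : #|` L t|%fset + (L t != fset0) <= \sum_i n * boundary (x i) (L t).
    have [->|Lt0] := eqVneq (L t) fset0; first by rewrite cardfs0.
    have [i] : exists i, #|` L t|%fset < n * boundary (x i) (L t).
      apply: contrapT => noi; apply: noL; exists t; split=> // i; rewrite leqNgt.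
      by apply/negP => lti; apply: noi; exists i.
    by rewrite addn1 => lti; apply: leq_trans lti _; rewrite (bigD1 i) //= leq_addr.
  have L0 : L 0 != fset0.
    case: (ws) ws0 (LP 0) => // w ws' _ L0P; apply/fset0Pn; exists (eval x w).
    by rewrite L0P mult_gt0 mem_head.
  suff : \sum_(t < size ws) (#|` L t|%fset + (L t != fset0)) <= size ws.
    rewrite big_split sumL /= -[leqRHS]addn0 leq_add2l.
    by case: (size ws) ws0 => // m _; rewrite big_ord_recl /= L0.
  apply: (@leq_trans (\sum_(t < size ws) \sum_i n * boundary (x i) (L t))).
    by apply: leq_sum => t _; exact: bad.
  rewrite exchange_big /=; have [k0|k0] := posnP k.
    by rewrite big1 // => -[i ik]; exfalso; move: ik; rewrite k0.
  rewrite -(leq_pmul2l k0) big_distrr /= -[leqRHS](_ : \sum_(i < k) size ws = _); last first.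
    by rewrite sum_nat_const card_ord.
  by apply: leq_sum => i _; rewrite -big_distrr /= mulnA.
exists (L t); first exact/folner_setE.
rewrite cardL.
apply: leq_trans (sum_mult x ws US); apply: leq_sum => g _.
by case: ltnP => // /(leq_ltn_trans (leq0n _)).
Qed.

Lemma folner_function_le n O : folner_set x n O ->
  exists2 m, folner_function x n = Some m & m <= #|` O|%fset.
Proof.
move=> OF; rewrite /folner_function; case: pselect => [ex|[]]; last first.
  by exists #|` O|%fset; apply/asboolP; exists O.
exists (ex_minn ex) => //; case: ex_minnP => m _; apply.
by apply/asboolP; exists O.
Qed.

Lemma amenable_subrecursive_folner :
  generating x -> word_problem_re x -> amenable_wrt x -> subrecursive_folner_wrt x.
Proof.
move=> genx rex amx; have [f [cf fP]] := matched_words k genx rex amx.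
exists (fun n => size (f n)).
  have : computable (fun n => size (f n)) by computability.
  by [].
move=> n n0; have [O /folner_function_le[m -> mO] sO] := matched_folner n0 (fP n).
by exists m => //; apply: leq_trans sO.
Qed.

End Reiter.

(** * Reiter functions and the word problem *)

Section Pushforward.
Local Open Scope ring_scope.
Variables (G : groupType) (k : nat) (x : 'I_k -> G).

(** The pair [(1, 0)] stands for the rational [1 / (0 + 1)]. Masses of words with the same reduction
    add up. *)
Definition unit_masses (ws : seq (seq ('I_k * bool))) : seq (free_group 'I_k * (nat * nat)) :=
  [seq (reduce w, (1%N, 0%N)) | w <- ws].

Lemma pushforward_unit_masses ws g :
  pushforward x (fun_of_seq (unit_masses ws)) g = (mult x ws g)%:R.
Proof.
have massE w : fun_of_seq (unit_masses ws) w = \sum_(u <- ws) (reduce u == w)%:R.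
  rewrite /fun_of_seq /unit_masses big_map big_mkcond /=; apply: eq_bigr => u _.
  by rewrite divr1; case: eqP.
rewrite /pushforward fsbig_mkcond (fsbigTE [fset w in map (@reduce k) ws]%fset); last first.
  move=> w; rewrite !inE /= /patch massE => wN; case: ifP => // _.
  by rewrite big_seq big1 // => u uws; case: eqP => // uw; rewrite -uw map_f in wN.
pose A := [fset w in map (@reduce k) ws]%fset.
transitivity (\sum_(w <- A) \sum_(u <- ws) (eval x u == g)%:R * (reduce u == w)%:R : rat).
  apply: eq_bigr => w _; rewrite /patch massE; case: ifPn => [|].
    rewrite inE /= => wg; apply: eq_bigr => u _; have [uw|] := eqVneq (reduce u);
      last by rewrite mulr0.
    by rewrite -proj_reduce uw wg eqxx mul1r.
  rewrite notin_setE /= => wg; rewrite big1 // => u _; have [uw|] := eqVneq (reduce u);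
    last by rewrite mulr0.
  by rewrite -proj_reduce uw; have /eqP/negbTE -> := wg; rewrite mul0r.
rewrite exchange_big /= /mult -sum1_count natr_sum [RHS]big_mkcond /= [LHS]big_seq [RHS]big_seq.
apply: eq_bigr => u uws; rewrite -mulr_sumr.
have -> : \sum_(w <- A) (reduce u == w)%:R = 1 :> rat.
  rewrite (bigD1_seq (reduce u)) ?fset_uniq //=; last by rewrite !inE map_f.
  by rewrite eqxx big1 ?addr0 // => w /negbTE; rewrite eq_sym => ->.
by rewrite mulr1; case: eqP.
Qed.

(** The difference of the multiplicities is bounded by unreached and undefined words together, each
    at most a fraction [1 / (2 n)] of [ws]; hence the factor 2. *)
Lemma matched_invariant n ws : (0 < n)%N -> matched x (2 * n)%N ws ->
  Defs.invariant x n (fun g => (mult x ws g)%:R).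
Proof.
move=> n0 [/andP[Uws ws0] wsm].
have supp g : (mult x ws g)%:R != 0 :> rat -> g \in map (eval x) ws.
  by rewrite pnatr_eq0 -lt0n mult_gt0.
split.
- apply: (@sub_finite_set _ _ [set` map (eval x) ws]%classic) => [g /supp //|].
  exact: finite_seq.
- by move=> g; rewrite ler0n.
- case: ws ws0 {Uws wsm supp} => // w ws _; exists (eval x w).
  by rewrite pnatr_eq0 -lt0n mult_gt0 mem_head.
move=> i; have [m [mm mE]] := wsm i (mem_enum _ i).
have [ds [es [sds ses dsE]]] := mult_matching Uws mm mE.
have /and5P[_ _ _ _ mn] := mm.
pose S := map (eval x) ws.
have mult0 g : g \notin S -> mult x ws g = 0%N.
  by move=> gS; apply/eqP; rewrite -leqn0 leqNgt mult_gt0.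
rewrite (fsbigTE [fset g in S]%fset (fun g => (mult x ws g)%:R)); last first.
  by move=> g; rewrite inE /=; apply: contraNeq => /supp.
rewrite -natr_sum sum_mult_supp ?fset_uniq //; last by move=> g gS; rewrite inE.
(* A finite set containing the supports of the multiplicity function and of its translate. *)
pose A := [fset g in S ++ map (fun g => (x i * g)%g) S]%fset.
rewrite (fsbigTE A); last first.
  move=> g; rewrite !inE negb_or => /andP[gS xgS]; apply/eqP; rewrite normr_eq0.
  rewrite (mult0 _ gS) mult0 ?subrr //; apply: contra xgS => gS'.
  by apply/mapP; exists ((x i)^-1 * g)%g; rewrite ?mulVKg.
apply: (@le_trans _ _ (\sum_(g <- A) (mult x ds g + mult x es ((x i)^-1 * g)%g)%:R)).
  apply: ler_sum => g _; have := dsE g.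
  set a := mult x ws g; set b := mult x ws _; set c := mult x ds _; set d := mult x es _ => abcd.
  have -> : a%:R - b%:R = c%:R - d%:R :> rat.
    by apply/eqP; rewrite subr_eq -addrAC eq_sym subr_eq -!natrD addnC -abcd.
  by rewrite natrD (le_trans (ler_normB _ _)) // !normr_nat.
rewrite -natr_sum ler_pdivlMl ?ltr0n // -natrM ler_nat; apply: leq_trans mn.
rewrite [(2 * n)%N]mulnC -mulnA leq_mul2l mul2n -addnn big_split /= leq_add ?orbT //.
  by rewrite -sds sum_mult // fset_uniq.
rewrite -ses -(big_map (fun g => (x i)^-1 * g)%g predT (mult x es)) sum_mult //.
by rewrite map_inj_uniq ?fset_uniq //; apply: mulgI.
Qed.

End Pushforward.

(** Of two elements with the same image one could be removed without changing the image, which would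
    then have fewer elements than [A]. *)
Lemma imfset_card_inj (S T : choiceType) (f : S -> T) (A : {fset S}) :
  #|` A|%fset = #|` [fset f a | a in A]%fset|%fset -> {in A &, injective f}.
Proof.
move=> cardA u v uA vA fuv; apply/eqP; apply: contraT => uv.
suff : #|` A|%fset < #|` A|%fset by rewrite ltnn.
rewrite {1}cardA (cardfsD1 v A) vA add1n ltnS.
have -> : [fset f a | a in A]%fset = [fset f a | a in (A `\ v)%fset]%fset;
  last exact: leq_imfset_card.
apply/fsetP => y; apply/imfsetP/imfsetP => -[a /= aA ->]; last first.
  by exists a => //; move: aA; rewrite !inE => /andP[].
have [av|av] := eqVneq a v; last by exists a; rewrite // !inE av.
by exists u; rewrite ?av ?fuv // !inE uv.
Qed.

Lemma imfset_proj_reduce (G : groupType) k (x : 'I_k -> G) ws :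
  [fset proj x w | w in [fset w in map (@reduce k) ws]]%fset = [fset g in map (eval x) ws]%fset.
Proof.
apply/fsetP => g; rewrite inE; apply/imfsetP/mapP => /= [[w]|[w ww ->]].
  by rewrite inE => /mapP[u uws -> ->]; exists u; rewrite ?proj_reduce.
by exists (reduce w); rewrite ?proj_reduce // inE map_f.
Qed.

Section ReiterFunctions.
Variables (G : groupType) (k : nat) (x : 'I_k -> G).

Lemma matchedW m n ws : m <= n -> matched x n ws -> matched x m ws.
Proof.
move=> mn [wsP wsm]; split=> // i /wsm [t [/and5P[tu tv uws vws tn] tE]]; exists t; split=> //.
by apply/and5P; split=> //; apply: leq_trans tn; rewrite leq_mul2r mn orbT.
Qed.

Lemma amenable_computable_reiter :
  generating x -> word_problem_re x -> amenable_wrt x -> computable_reiter_wrt x.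
Proof.
move=> genx rex amx; have [f [cf fP]] := matched_words 2 genx rex amx.
have [c cP] : computable (fun n => unit_masses (f n)) by rewrite /unit_masses; computability.
exists c => n n0; exists (fun_of_seq (unit_masses (f n))).
  by exists (unit_masses (f n)); split=> //; apply: cP.
rewrite (_ : pushforward _ _ = fun g => (mult x (f n) g)%:R%R).
  by apply: matched_invariant => //; apply: matchedW (fP n).
by apply/funext => g; rewrite pushforward_unit_masses.
Qed.

(** * The word problem and Folner sets by one-to-one preimages *)

Lemma solvable_computable_eval : solvable_word_problem_wrt x ->
  computable (fun s => `[<eval x s = 1%g>]).
Proof.
move=> /recursive_setP wpx.
apply: (eq_computable _ (computable_comp wpx (computable_reduce computable_id))).
by move=> s; rewrite /ker_proj /= proj_reduce.
Qed.

Lemma solvable_computable_folner_injective :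
  generating x -> solvable_word_problem_wrt x -> amenable_wrt x ->
  computable_folner_injective_wrt x.
Proof.
move=> genx /solvable_computable_eval wpx amx.
have rex : word_problem_re x.
  by apply: eq_semidecidable (semidecidable_bool wpx) => s; split=> /asboolP.
pose distinct ws := all (fun u => all (fun v => (u == v) || ~~ `[<eval x (u ++ inv_word v) =
  1%g>]) ws) ws.
have distinctP ws : reflect {in ws &, injective (eval x)} (distinct ws).
  apply: (iffP allP) => [ws_inj u v uws vws uv|ws_inj u uws].
    have /allP/(_ v vws) := ws_inj u uws; rewrite eval_cat eval_inv uv mulgV.
    by case/orP=> [/eqP //|/asboolP].
  apply/allP => v vws; case: eqP => //= uv; apply/asboolP.
  by rewrite eval_cat eval_inv => /divg1_eq /(ws_inj _ _ uws vws).
have [f [cf fP]] : exists f : nat -> seq (seq ('I_k * bool)), computable f /\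
    forall n, matched x n.+1 (f n) /\ distinct (f n).
  apply: (semidecidable_search (A := fun n ws => matched x n.+1 ws /\ distinct ws)).
  - apply: semidecidable_and.
      apply: (semidecidable_comp (semidecidable_matched rex) (f := fun t => (t.1.+1, t.2))).
      by computability.
    apply: semidecidable_bool; rewrite /distinct; computability.
    by apply: (computable_comp wpx); computability.
  - exact/enumerable_seq/enumerable_raw.
  - move=> n; have [O /(folner_matched genx (ltn0Sn _))[ws wsP ws_inj]] := amx _ (ltn0Sn n).
    by exists ws; split=> //; apply/distinctP.
(* [f n] is matched with parameter [n.+1], so the input [n] calls for [f n.-1]. *)
have [c cP] : computable (fun n => map (@reduce k) (f n.-1)) by computability.
exists c => -[//|n] _; have [[/andP[Uws ws0] wsm] /distinctP ws_inj] := fP n.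
set ws := f n in Uws ws0 wsm ws_inj *; set F := [fset w in map (@reduce k) ws]%fset.
set O := [fset proj x w | w in F]%fset.
have OE : O = [fset g in map (eval x) ws]%fset by apply: imfset_proj_reduce.
have OP g : (g \in O) = (0 < mult x ws g) by rewrite mult_gt0 OE inE.
have Ueval : uniq (map (eval x) ws) by rewrite map_inj_in_uniq.
have cardO : #|` O|%fset = size ws by rewrite OE card_fseq undup_id ?size_map.
exists F; split.
- by exists (map (@reduce k) ws); split=> //; apply: (cP n.+1).
- apply/folner_setE => //; rewrite -cardfs_gt0 cardO; split=> // i.
  have [m [mm mE]] := wsm i (mem_enum _ i).
  have [ds [es [sds ses dsE]]] := mult_matching Uws mm mE.
  have /and5P[_ _ _ _ mn] := mm; apply: leq_trans mn; rewrite leq_mul2l -sds.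
  apply: leq_trans (sum_mult x ds (fset_uniq (O `\` translate (x i) O)%fset)).
  (* At a boundary point [g] the multiplicity of [(x i)^-1 * g] vanishes, so [g] is the value of an
     unreached word. *)
  rewrite /boundary -[X in X <= _]sum1_size big_seq [leqRHS]big_seq; apply: leq_sum => g.
  rewrite in_fsetD mem_translate => /andP[].
  rewrite -/O !OP -leqNgt leqn0 => /eqP g0 g1.
  by have := dsE g; rewrite g0 add0n => <-; rewrite addn_gt0 g1.
- rewrite cardO card_fseq undup_id ?size_map // map_inj_in_uniq // => u v uws vws uv.
  by apply: ws_inj => //; rewrite -!proj_reduce uv.
Qed.

Lemma computable_folner_injective_solvable :
  word_problem_re x -> computable_folner_injective_wrt x -> solvable_word_problem_wrt x.
Proof.
move=> rex [c cP].
have /choice[F FP] n : exists s : seq (free_group 'I_k),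
    [/\ run c n.+1 (enc s), {in s &, injective (proj x)} &
        folner_set x n.+1 [fset proj x w | w in [fset w in s]]%fset].
  have [_ [[s [-> run_s]] sF card_s]] := cP n.+1 (ltn0Sn n).
  have inj := imfset_card_inj card_s.
  by exists s; split=> // u v us vs; apply: inj; rewrite inE.
have cF : computable F.
  have [d dP] : computable S by computability.
  by exists (Comp c d) => n; exists n.+1; [apply: dP | case: (FP n)].
(* [F (size w)] maps onto a Folner set with parameter [(size w).+1], just more than the length of
   [w]. *)
pose A (w : seq ('I_k * bool)) (t : seq ('I_k * bool) * seq ('I_k * bool)) :=
  (t.1 \in map (@word _) (F (size w))) && (t.2 \in map (@word _) (F (size w))) /\
  eval x (w ++ t.1) = eval x t.2.
have [f [cf fP]] : exists f, computable f /\ forall w, A w (f w).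
  apply: semidecidable_search.
  - apply: semidecidable_and; first by apply: semidecidable_bool; computability.
    apply: (semidecidable_comp (semidecidable_eval_eq rex) (f := fun t => (t.1 ++ t.2.1, t.2.2))).
    by computability.
  - by apply: enumerable_prod; apply: enumerable_raw.
  - move=> w; have [_ _ /(folner_setE _ _ (ltn0Sn _))[O0 On]] := FP (size w).
    set O := [fset proj x w | w in _]%fset in O0 On.
    (* If [O] were disjoint from its translate by [w], its boundary would be all of [O], against the
       bound for words of length [size w]. *)
    have /fset0Pn[g] : (O `&` translate (eval x w) O)%fset != fset0.
      apply: contraNneq O0 => OI; have := boundary_eval w On.
      rewrite /boundary cardfsD OI cardfs0 subn0 mulSn -[leqRHS]add0n leq_add2r leqn0.
      by rewrite cardfs_eq0.
    rewrite inE mem_translate => /andP[/imfsetP[v /= vF gv] /imfsetP[u /= uF gu]].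
    rewrite !inE /= in uF vF; exists (word u, word v); split; first by rewrite /= !map_f.
    by rewrite /= eval_cat -[eval x (word u)]/(proj x u) -gu mulVKg gv.
(* Both words found come from a list on which [proj] is injective, so equality in the group is
   equality of words. *)
have fE w : `[<proj x w = 1%g>] = ((f (word w)).1 == (f (word w)).2).
  have [/andP[/mapP[u uF uE] /mapP[v vF vE]] wuv] := fP (word w).
  rewrite eval_cat uE vE in wuv; rewrite {}uE {}vE.
  apply/asboolP/eqP => [w1|/val_inj uv].
    congr word; case: (FP (size (word w))) => _ inj _; apply: inj => //.
    by move: wuv; rewrite (w1 : eval x (word w) = 1%g) mul1g.
  by apply: (@mulIg _ (eval x (word u))); rewrite mul1g wuv uv.
have [d dP] : computable (fun w : free_group 'I_k => `[<proj x w = 1%g>]).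
  apply: (eq_computable (fun w => esym (fE w))); computability.
exists d => w; have := dP w; case: asboolP => /= [w1|w1] dw; split=> //.
Qed.

End ReiterFunctions.

(** * Slabs *)

Section Slabs.
Variables (G : groupType) (k : nat) (x : 'I_k -> G) (t : 'I_k) (height : G -> int).
Local Open Scope ring_scope.
Hypothesis heightM : forall g h, height (g * h)%g = height g + height h.
Hypothesis height_gen : forall i, height (x i) = (i == t)%:R.

(* When the kernel of [height] is locally finite, the elements [x t ^+ j * h] form
   such a set, for [0 <= j < n] and for [h] in a finite subgroup that contains the
   conjugates of the other generators by the powers [x t ^+ j]. *)
Definition slab (n : nat) (P : G -> Prop) : Prop :=
  (exists g, P g) /\ forall g, P g ->
    [/\ 0 <= height g < n%:Z, forall i, i != t -> P (x i * g)%g,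
        height g + 1 < n%:Z -> P (x t * g)%g & 0 < height g -> P ((x t)^-1 * g)%g].

Lemma height1 : height 1%g = 0.
Proof. by have /eqP := heightM 1%g 1%g; rewrite mulg1 -subr_eq subrr eq_sym => /eqP. Qed.

Lemma heightV g : height g^-1%g = - height g.
Proof. by apply/eqP; rewrite -addr_eq0 -heightM mulVg height1. Qed.

Lemma heightX g n : height (g ^+ n)%g = height g *+ n.
Proof. by elim: n => [|n IHn]; rewrite ?height1 // expgS heightM IHn mulrS. Qed.

Definition ups (s : seq ('I_k * bool)) : nat := count (fun l => l == (t, false)) s.
Definition downs (s : seq ('I_k * bool)) : nat := count (fun l => l == (t, true)) s.

Lemma height_eval s : height (eval x s) = (ups s)%:Z - (downs s)%:Z.
Proof.
elim: s => [|[i b] s IHs]; first by rewrite eval_nil height1.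
rewrite eval_cons heightM IHs /ups /downs /= !xpair_eqE.
by case: b; rewrite ?heightV height_gen; case: (i == t) => /=; lia.
Qed.

(** Only the shift [x t] has a boundary, which lies at height 0. Its translates by [x t ^+ j], for
    [j < n], stay in [O] and are disjoint because their heights differ. *)
Lemma slab_folner n (O : {fset G}) : (0 < n)%N -> slab n (fun g => g \in O) -> folner_set x n O.
Proof.
move=> n0 [[a aO] OP]; apply/folner_setE => //.
split=> [|i]; first by apply/fset0Pn; exists a.
have [->|it] := eqVneq i t; last first.
  rewrite /boundary cardfsD (fsetIidPr _) ?card_translate ?subnn ?muln0 //.
  by apply/fsubsetP => _ /imfsetP[g /= gO ->]; have [_ + _ _] := OP g gO; apply.
set B := (O `\` translate (x t) O)%fset.
have BP g : g \in B -> g \in O /\ height g = 0.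
  rewrite in_fsetD mem_translate => /andP[xgO gO]; split=> //.
  have [/andP[g_ge0 _] _ _ gV] := OP g gO; apply: contraNeq xgO => g_neq0.
  by apply: gV; rewrite lt_neqAle eq_sym g_neq0.
have slice j g : (j < n)%N -> g \in B -> (x t ^+ j * g)%g \in O.
  move=> + /BP[gO g0]; elim: j => [|j IHj] jn; first by rewrite mul1g.
  have [_ _ + _] := OP _ (IHj (ltnW jn)); rewrite expgS -mulgA; apply.
  by rewrite heightM heightX height_gen eqxx g0; lia.
pose s := [seq (x t ^+ j * g)%g | j <- iota 0 n, g <- B].
have -> : (n * boundary (x t) O = size s)%N by rewrite size_allpairs size_iota.
apply: uniq_leq_size; last first.
  by move=> _ /allpairsP[[j g] [/= +  gB ->]]; rewrite mem_iota => jn; apply: slice.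
apply: allpairs_uniq; rewrite ?iota_uniq ?fset_uniq //.
move=> [i1 g1] [i2 g2] /allpairsP[[j1 h1] [/= _ /BP[_ h1E] [-> ->]]].
move=> /allpairsP[[j2 h2] [/= _ /BP[_ h2E] [-> ->]]] eq_jh.
have := congr1 height eq_jh; rewrite !heightM !heightX height_gen eqxx h1E h2E => j12.
have {}j12 : j1 = j2 by lia.
by move: eq_jh; rewrite j12 => /mulgI ->.
Qed.

Hypothesis rex : word_problem_re x.

(** Heights are read off from the words. Each implication from a condition on heights to a
    membership becomes a disjunction of a decidable and a semidecidable statement. *)
Lemma semidecidable_slab : semidecidable
  (fun p : nat * seq (seq ('I_k * bool)) => slab p.1.+1 (fun g => g \in map (eval x) p.2)).
Proof.
pose stays (ws : seq (seq ('I_k * bool))) w := exists2 v, v \in ws & eval x w = eval x v.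
have stays_re : semidecidable (fun p : seq (seq ('I_k * bool)) * seq ('I_k * bool) => stays p.1
  p.2).
  apply: semidecidable_has; [|exact: enumerable_raw|by computability].
  apply: (semidecidable_comp (semidecidable_eval_eq rex) (f := fun p => (p.1.2, p.2))).
  by computability.
pose ok n ws w := ((downs w <= ups w) && (ups w < downs w + n.+1))%N /\
  ((forall i, i \in enum 'I_k -> i == t \/ stays ws ((i, false) :: w)) /\
  (((downs w + n <= ups w)%N \/ stays ws ((t, false) :: w)) /\
   ((ups w <= downs w)%N \/ stays ws ((t, true) :: w)))).
apply: (@eq_semidecidable _ _ (fun p : nat * seq (seq ('I_k * bool)) =>
  (0 < size p.2)%N /\ forall w, w \in p.2 -> ok p.1 p.2 w)).
  move=> [n ws] /=.
  have staysE w : stays ws w <-> eval x w \in map (eval x) ws.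
    by split=> [[v vws ->]|/mapP[v vws wv]]; [exact: map_f | exists v].
  split=> [[ws0 wsP]|[[g /mapP[w wws _]] wsP]].
    split; first by case: ws ws0 {wsP staysE} => // w ws _; exists (eval x w); rewrite mem_head.
    move=> _ /mapP[w /wsP[hw [wx [wt wV]]] ->]; rewrite height_eval; split.
    - lia.
    - move=> i it; have [it'|/staysE] := wx i (mem_enum _ i); first by rewrite it' in it.
      by rewrite eval_cons.
    - by move=> hw'; case: wt => [|/staysE]; [lia | rewrite eval_cons].
    - by move=> hw'; case: wV => [|/staysE]; [lia | rewrite eval_cons].
  split; first by case: (ws) wws.
  move=> v /(map_f (eval x)) /wsP; rewrite height_eval => -[hv vx vt vV]; split; first by lia.
  split; [|split].
  - move=> i _; have [|it] := boolP (i == t); [by left | right].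
    by apply/staysE; rewrite eval_cons; apply: vx.
  - have [|hv'] := leqP (downs v + n) (ups v); [by left | right].
    by apply/staysE; rewrite eval_cons; apply: vt; lia.
  - have [|hv'] := leqP (ups v) (downs v); [by left | right].
    by apply/staysE; rewrite eval_cons; apply: vV; lia.
have stays_cons (S : Type) (ES : encodable S) (ws : S -> seq (seq ('I_k * bool)))
    (l : S -> 'I_k * bool) (w : S -> seq ('I_k * bool)) :
    computable ws -> computable l -> computable w ->
      semidecidable (fun s => stays (ws s) (l s :: w s)).
  move=> cws cl cw; apply: (semidecidable_comp stays_re (f := fun s => (ws s, l s :: w s))).
  by computability.
apply: semidecidable_and; first by apply: semidecidable_bool; computability.
apply: semidecidable_all; last by computability.
rewrite /ok /ups /downs.
apply: semidecidable_and; first by apply: semidecidable_bool; computability.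
apply: semidecidable_and.
  apply: (semidecidable_all (l := fun=> enum 'I_k)
    (A := fun (s : _ * _) i => i == t \/ stays s.1.2 ((i, false) :: s.2))); last by computability.
  apply: semidecidable_or; first by apply: semidecidable_bool; computability.
  by apply: stays_cons; computability.
apply: semidecidable_and; apply: semidecidable_or; try by apply: semidecidable_bool;
  computability.
  by apply: stays_cons; computability.
by apply: stays_cons; computability.
Qed.

(** Being a slab concerns the image in the group only, so the search certifies a Folner set without
    knowing which of its words coincide. *)
Lemma slab_computable_folner : generating x ->
  (forall n, exists O : {fset G}, slab n.+1 (fun g => g \in O)) -> computable_folner_wrt x.
Proof.
move=> genx slabs; have [r rE] := choice (generating_eval genx).
have [f [cf fP]] : exists f : nat -> seq (seq ('I_k * bool)), computable f /\
    forall n, slab n.+1 (fun g => g \in map (eval x) (f n)).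
  apply: (semidecidable_search (A := fun n ws => slab n.+1 (fun g => g \in map (eval x) ws))).
  - exact: semidecidable_slab.
  - exact/enumerable_seq/enumerable_raw.
  move=> n; have [O OP] := slabs n; exists (map r O).
  by rewrite -map_comp map_id_in //= => g _; rewrite rE.
have [c cP] : computable (fun n => map (@reduce k) (f n.-1)) by computability.
exists c => -[//|n] _; exists [fset w in map (@reduce k) (f n)]%fset.
  by exists (map (@reduce k) (f n)); split=> //; apply: (cP n.+1).
rewrite imfset_proj_reduce; apply: slab_folner => //.
suff <- : (fun g => g \in map (eval x) (f n) : Prop) =
    (fun g => g \in [fset g in map (eval x) (f n)]%fset : Prop) by apply: fP.
by apply/funext => g; rewrite inE.
Qed.

End Slabs.

(** * From an enumeration of the trivial words to a recursive set of relators *)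

Lemma size_foldr_push (T : choiceType) (u v : seq (T * bool)) :
  size v <= size (foldr (@push T) v u) + size u.
Proof.
elim: u => [|a u IHu] /=; first by rewrite addn0.
apply: leq_trans IHu _; rewrite addnS -addSn leq_add2r.
by case: (foldr _ _ u) => //= b w; case: ifP => _ //=; rewrite ltnW.
Qed.

Lemma foldr_push_nseq (T : choiceType) n (i : T) (b : bool) :
  foldr (@push T) [::] (nseq n (i, b)) = nseq n (i, b).
Proof.
elim: n => //= n ->; case: n => //= n; rewrite /inv_letter xpair_eqE.
by case: b; rewrite andbF.
Qed.

(* The relators of an enumeration become recognizable by their length once the
   [n]-th one is multiplied by a long enough power of an involution. *)
Lemma word_problem_re_recursively_presentable (G : groupType) k (x : 'I_k -> G) i :
  (x i * x i = 1)%g -> word_problem_re x -> recursively_presentable_wrt x.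
Proof.
move=> xi2 [p [cp pP]]; have [e [ce eP]] := enumerable_raw k.
pose r n := if e (nfst n) is Some s then if p s (nsnd n) then s else [::] else [::].
(* The even length makes the padding trivial in the group; after at most [size (r n)] cancellations
   more than enough of it remains to give length [n]. *)
pose pad n := nseq (size (r n) + n).*2 (i, false).
pose rel n := r n ++ pad n.
pose R : set (free_group 'I_k) :=
  [set w | w = reduce [:: (i, false); (i, false)] \/ exists n, w = reduce (rel n)]%classic.
have r1 n : eval x (r n) = 1%g.
  rewrite /r; case: (e _) => [s|]; last exact: eval_nil.
  by case: ifP => [ps|_]; [apply/pP; exists (nsnd n) | exact: eval_nil].
have pad1 n : eval x (pad n) = 1%g.
  by rewrite eval_nseq eval_gen -muln2 mulnC expgnA expg2 xi2 expg1n.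
have size_rel n : n <= size (word (reduce (rel n))).
  have := size_foldr_push (r n) (foldr (@push _) [::] (pad n)).
  by rewrite -foldr_cat foldr_push_nseq size_nseq /= -/(rel n); lia.
(* The [n]-th relator has length at least [n], so only indices up to the length of [w] are
   tested. *)
have RE w : `[<R w>] = (w == reduce [:: (i, false); (i, false)]) ||
    has (fun n => w == reduce (rel n)) (iota 0 (size (word w)).+1).
  apply/asboolP/orP => [[->|[n ->]]|[/eqP->|/hasP[n _ /eqP->]]].
  - by left.
  - by right; apply/hasP; exists n => //; rewrite mem_iota /= add0n ltnS size_rel.
  - by left.
  - by right; exists n.
exists R.
  have [c cP] : computable (fun w => `[<R w>]).
    apply: (eq_computable (fun w => esym (RE w))); rewrite /rel /pad /r.
    under eq_fun do under eq_has do rewrite -addnn; computability.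
  by exists c => w; have := cP w; case: asboolP.
apply/seteqP; split.
  apply: smallest_sub.
    split; [split|].
    - by rewrite /ker_proj /= /proj big_nil.
    - by move=> g h; rewrite /ker_proj /= projM => -> ->; rewrite mulg1.
    - move=> g; rewrite /ker_proj /= => g1.
      by rewrite -(mul1g (proj x g^-1)%g) -{1}g1 -projM mulgV /proj big_nil.
    move=> g h; rewrite /ker_proj /= !projM => ->.
    by rewrite mulg1 -projM mulgV /proj big_nil.
  move=> w [->|[n ->]]; rewrite /ker_proj /= proj_reduce.
    by rewrite eval_cons eval_gen.
  by rewrite eval_cat r1 pad1 mulg1.
move=> w w1 N [[[N1 NM NV] _] RN].
(* The square of the involution is a relator, so the padding can be cancelled inside the normal
   closure. *)
have Npad n : N (reduce (nseq n.*2 (i, false))).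
  elim: n => [|n IHn]; first by rewrite (_ : reduce _ = 1%g) //; apply: val_inj.
  rewrite doubleS -[nseq _ _]/([:: (i, false); (i, false)] ++ nseq n.*2 (i, false)) reduce_cat.
  by apply: NM => //; apply: RN; left.
have [m pm] := (pP (word w)).1 w1; have [n en] := eP (word w).
have rE : r (npair n m) = word w by rewrite /r nfst_pair nsnd_pair en pm.
have : N (reduce (rel (npair n m))) by apply: RN; right; exists (npair n m).
rewrite reduce_cat rE reduce_word => /(NM _ _)/(_ (NV _ (Npad (size (r (npair n m)) + npair n
  m)))).
by rewrite mulgK.
Qed.

(** * A group with unsolvable word problem *)

(* The group [(int * int -> 'S_3) ><| int], in which [int] translates both
   coordinates simultaneously. *)
Record lamp : Type := Lamp { height : int; lamps : int -> int -> 'S_3 }.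

HB.instance Definition _ := gen_eqMixin lamp.
HB.instance Definition _ := gen_choiceMixin lamp.

Section LampGroup.
Local Open Scope ring_scope.
Implicit Types g h : lamp.

Lemma lamp_eq g h : height g = height h -> (forall p q, lamps g p q = lamps h p q) -> g = h.
Proof. by case: g h => m f [n e] /= -> fe; congr Lamp; apply/funext => p; apply/funext. Qed.

Definition lamp_mul g h : lamp :=
  Lamp (height g + height h)
       (fun p q => lamps g p q * lamps h (p - height g) (q - height g))%g.
Definition lamp_one : lamp := Lamp 0 (fun _ _ => 1%g).
Definition lamp_inv g : lamp :=
  Lamp (- height g) (fun p q => (lamps g (p + height g) (q + height g))^-1)%g.

Lemma lamp_mulA : associative lamp_mul.
Proof. by move=> f g h; apply: lamp_eq => [|p q] /=; rewrite ?addrA // mulgA !opprD !addrA. Qed.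

Lemma lamp_mul1g : left_id lamp_one lamp_mul.
Proof. by move=> g; apply: lamp_eq => [|p q] /=; rewrite ?add0r // mul1g !subr0. Qed.

Lemma lamp_mulg1 : right_id lamp_one lamp_mul.
Proof. by move=> g; apply: lamp_eq => [|p q] /=; rewrite ?addr0 // mulg1. Qed.

Lemma lamp_mulVg : left_inverse lamp_one lamp_inv lamp_mul.
Proof. by move=> g; apply: lamp_eq => [|p q] /=; rewrite ?addNr // !opprK mulVg. Qed.

Lemma lamp_mulgV : right_inverse lamp_one lamp_inv lamp_mul.
Proof. by move=> g; apply: lamp_eq => [|p q] /=; rewrite ?subrr // !subrK mulgV. Qed.

End LampGroup.

HB.instance Definition _ :=
  isGroup.Build lamp lamp_mulA lamp_mul1g lamp_mulg1 lamp_mulVg lamp_mulgV.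

(** * The subgroup generated by a finite family *)

Section GeneratedSubgroup.
Variables (A : groupType) (k : nat) (x : 'I_k -> A).

Record gen_group : predArgType := GenGroup { spanned :> A;
  spanned_eval : `[<exists s, eval x s = spanned>] }.

HB.instance Definition _ := [isSub for spanned].
HB.instance Definition _ := [Choice of gen_group by <:].

Lemma span_group_closed : group_closed (fun g : A => `[<exists s, eval x s = g>]).
Proof.
split; first by apply/asboolP; exists [::]; apply: eval_nil.
move=> _ _ /asboolP[u <-] /asboolP[v <-]; apply/asboolP.
by exists (u ++ inv_word v); rewrite eval_cat eval_inv.
Qed.

HB.instance Definition _ := SubChoice_isSubGroup.Build A _ gen_group span_group_closed.

Lemma span_genP i : `[<exists s, eval x s = x i>].
Proof. by apply/asboolP; exists [:: (i, false)]; apply: eval_gen. Qed.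

Definition span_gen (i : 'I_k) : gen_group := GenGroup (span_genP i).

Lemma spannedM (g h : gen_group) : spanned (g * h)%g = (spanned g * spanned h)%g.
Proof. exact: valM. Qed.

Lemma spanned1 : spanned 1%g = 1%g.
Proof. exact: val1. Qed.

Lemma spannedV (g : gen_group) : spanned g^-1%g = (spanned g)^-1%g.
Proof. by apply: (@mulgI _ (spanned g)); rewrite -spannedM !mulgV spanned1. Qed.

Lemma spanned_span_eval s : spanned (eval span_gen s) = eval x s.
Proof.
elim: s => [|l s IHs]; first by rewrite !eval_nil spanned1.
by rewrite !eval_cons spannedM IHs; case: l.2; rewrite ?spannedV.
Qed.

Lemma span_generating : injective x -> generating span_gen.
Proof.
move=> injx; apply: eval_generating => [i j /(congr1 spanned) /injx //|g].
have /asboolP[s sg] := spanned_eval g.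
by exists s; apply: val_inj; rewrite /= spanned_span_eval.
Qed.

End GeneratedSubgroup.

(** * Generators supported off the killed diagonals *)

Section KilledLamps.
Variable K : nat -> Prop.
Local Open Scope ring_scope.

Definition o0 : 'I_3 := inord 0.
Definition o1 : 'I_3 := inord 1.
Definition o2 : 'I_3 := inord 2.

(** [alpha] and [beta] are involutions that do not commute. *)
Definition alpha : 'S_3 := tperm o0 o1.
Definition beta : 'S_3 := tperm o1 o2.

Definition killed (p q : int) : Prop := exists d : nat, q = p + d%:Z /\ K d.

(* The generators are the shift and two involutions, supported on [p = 0] and on
   [q = 0].  The [d]-th conjugate of the second one by the shift has support
   [q = d], hence it commutes with the first one unless the coordinate [(0, d)],
   where [alpha] and [beta] meet, survives. *)
Definition lamp_gen (i : 'I_3) : lamp :=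
  if i == o0 then Lamp 1 (fun _ _ => 1%g)
  else if i == o1 then Lamp 0 (fun p q => if (p == 0) && ~~ `[<killed p q>] then alpha else 1%g)
  else Lamp 0 (fun p q => if (q == 0) && ~~ `[<killed p q>] then beta else 1%g).

Lemma o01 : (o1 == o0) = false. Proof. by apply/eqP => /(congr1 val); rewrite /= !inordK. Qed.
Lemma o02 : (o2 == o0) = false. Proof. by apply/eqP => /(congr1 val); rewrite /= !inordK. Qed.
Lemma o12 : (o2 == o1) = false. Proof. by apply/eqP => /(congr1 val); rewrite /= !inordK. Qed.

Lemma ord3P (P : 'I_3 -> Prop) : P o0 -> P o1 -> P o2 -> forall i, P i.
Proof.
move=> P0 P1 P2 [[|[|[|//]]] i3]; [move: P0 | move: P1 | move: P2];
  by congr P; apply: val_inj; rewrite /= inordK.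
Qed.

Lemma alpha_neq1 : alpha != 1%g.
Proof. by apply/eqP => /permP/(_ o0)/eqP; rewrite tpermL perm1 o01. Qed.

Lemma killed_shift (p q r : int) : killed (p + r) (q + r) <-> killed p q.
Proof. by split=> -[d [e Kd]]; exists d; split=> //; lia. Qed.

Lemma killed_lt (p q : int) : q < p -> ~ killed p q.
Proof. by move=> qp [d [e _]]; lia. Qed.

Lemma lamp_gen_inj : injective lamp_gen.
Proof.
have h0 : height (lamp_gen o0) = 1 by rewrite /lamp_gen eqxx.
have h1 : height (lamp_gen o1) = 0 by rewrite /lamp_gen o01 eqxx.
have h2 : height (lamp_gen o2) = 0 by rewrite /lamp_gen o02 o12.
have n12 : lamp_gen o1 <> lamp_gen o2.
  (* The point [(0, -1)] lies below all killed diagonals, and only the first involution is lit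
     there. *)
  rewrite /lamp_gen o01 eqxx o02 o12 => /(congr1 (fun g => lamps g 0 (-1)))/eqP /=.
  by rewrite ?eqxx asboolF ?(negbTE alpha_neq1) //; apply: killed_lt.
elim/ord3P; elim/ord3P => // e; have := congr1 height e; rewrite ?h0 ?h1 ?h2 //.
by have := n12 (esym e).
Qed.

(** The lamp at [(p, q)] as it would be if nothing were killed. The sign of an involution letter is
    immaterial. *)
Fixpoint component (s : seq ('I_3 * bool)) (p q : int) : 'S_3 :=
  if s is l :: s' then
    if l.1 == o0 then if l.2 then component s' (p + 1) (q + 1) else component s' (p - 1) (q - 1)
    else if l.1 == o1 then ((if p == 0 then alpha else 1) * component s' p q)%g
    else ((if q == 0 then beta else 1) * component s' p q)%g
  else 1%g.

(** The killed set is invariant under the diagonal translation, so killing commutes with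
    evaluation. *)
Lemma lamps_eval s p q :
  lamps (eval lamp_gen s) p q = if `[<killed p q>] then 1%g else component s p q.
Proof.
elim: s p q => [|[i b] s IHs] p q; first by rewrite eval_nil if_same.
have inv1 c (a : 'S_3) : (a^-1 = a)%g -> ((if c then a else 1)^-1 = if c then a else 1)%g.
  by case: c; rewrite ?invg1.
rewrite eval_cons /=; elim/ord3P: i; rewrite /lamp_gen ?o01 ?o02 ?o12 ?eqxx; case: b => /=;
  rewrite ?invg1 ?mul1g ?oppr0 ?addr0 ?subr0 ?opprK IHs ?inv1 ?tpermV //.
- by rewrite (propext (killed_shift p q 1)).
- by rewrite (propext (killed_shift p q (-1))).
all: by case: asboolP; rewrite ?andbT ?andbF ?mul1g.
Qed.

Lemma eval_lamp_eq1 s : eval lamp_gen s = 1%g <->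
  height (eval lamp_gen s) = 0 /\ forall p q, killed p q \/ component s p q = 1%g.
Proof.
split=> [s1|[h0 s1]].
  split=> [|p q]; first by rewrite s1.
  by have := lamps_eval s p q; rewrite s1 /=; case: asboolP => [|_ <-]; [left | right].
apply: lamp_eq => //= p q; rewrite lamps_eval.
by have [/asboolP->|->] := s1 p q; rewrite ?if_same.
Qed.

(** A coordinate farther from 0 than the length of the word never becomes 0 during the
    evaluation. *)
Lemma component_farl s p p' q : (size s < `|p|)%N -> (size s < `|p'|)%N ->
  component s p q = component s p' q.
Proof.
elim: s p p' q => [//|[i b] s IHs] p p' q /= sp sp'; have := IHs p p' q.
have [p0 p'0] : (p == 0) = false /\ (p' == 0) = false by lia.
rewrite p0 p'0 => IH; case: eqP => _; first by case: b; apply: IHs; lia.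
by case: eqP => _; rewrite IH //; lia.
Qed.

Lemma component_farr s p q q' : (size s < `|q|)%N -> (size s < `|q'|)%N ->
  component s p q = component s p q'.
Proof.
elim: s p q q' => [//|[i b] s IHs] p q q' /= sq sq'; have := IHs p q q'.
have [q0 q'0] : (q == 0) = false /\ (q' == 0) = false by lia.
rewrite q0 q'0 => IH; case: eqP => _; first by case: b; apply: IHs; lia.
by case: eqP => _; rewrite IH //; lia.
Qed.

(* A coordinate beyond the reach of [s] may be moved anywhere beyond it, in
   particular to a place where [p < q] fails, so that nothing is killed. *)
Lemma component_window s :
  (forall p q, (`|p| <= 3 * size s + 2)%N -> (`|q| <= 3 * size s + 2)%N ->
     killed p q \/ component s p q = 1%g) ->
  forall p q, killed p q \/ component s p q = 1%g.
Proof.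
move=> win p q; set l := size s in win.
have alive p' q' : q' < p' -> (`|p'| <= 3 * l + 2)%N -> (`|q'| <= 3 * l + 2)%N ->
    component s p' q' = 1%g.
  by move=> qp p'l q'l; have [/(killed_lt qp)|] := win p' q' p'l q'l.
have [pl|lp] := leqP `|p| l; have [ql|lq] := leqP `|q| l.
- by apply: win; lia.
(* The replacements stay beyond [l] and inside the window, and place the point at [q < p]. *)
- by right; rewrite (@component_farr _ _ _ (p - (2 * l + 1)%N%:Z)) -/l ?alive //; lia.
- by right; rewrite (@component_farl _ _ (q + (2 * l + 1)%N%:Z)) -/l ?alive //; lia.
- right; rewrite (@component_farl _ _ (l%:Z + 2)) -/l; try lia.
  by rewrite (@component_farr _ _ _ (l%:Z + 1)) -/l ?alive //; lia.
Qed.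

End KilledLamps.

Lemma enc_perm_inj : injective (fun a : 'S_3 => enum_rank a : nat).
Proof. exact: inj_comp (@ord_inj _) enum_rank_inj. Qed.
#[export] Instance perm_encodable : encodable 'S_3 := Encodable enc_perm_inj.

(** * Semidecidability of the word problem *)

Section LampWordProblem.
Variable K : nat -> Prop.
Hypothesis reK : semidecidable K.

Notation x := (span_gen (lamp_gen K)).

Lemma height_lamp_genE (i : 'I_3) : height (lamp_gen K i) = ((i == o0)%:R)%R.
Proof. by elim/ord3P: i; rewrite /lamp_gen ?o01 ?o02 ?o12 ?eqxx. Qed.

Lemma height_lampM (g h : lamp) : height (g * h)%g = (height g + height h)%R.
Proof. by []. Qed.

Lemma height_lamp_eval s : height (eval (lamp_gen K) s) = ((ups o0 s)%:Z - (downs o0 s)%:Z)%R.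
Proof. exact: (height_eval height_lampM height_lamp_genE). Qed.

(* [component] computed from left to right on natural numbers: the state holds an
   origin [N], [p + N], [q + N] and the product so far. *)
Definition component_step (st : nat * (nat * (nat * 'S_3))) (l : 'I_3 * bool) :=
  let N := st.1 in let p := st.2.1 in let q := st.2.2.1 in let a := st.2.2.2 in
  if l.1 == o0 then if l.2 then (N, (p.+1, (q.+1, a))) else (N.+1, (p, (q, a)))
  else if l.1 == o1 then (N, (p, (q, if p == N then (a * alpha)%g else a)))
  else (N, (p, (q, if q == N then (a * beta)%g else a))).

Lemma foldl_component_step s N p q a :
  (foldl component_step (N, (p, (q, a))) s).2.2.2 =
  (a * component s (p%:Z - N%:Z)%R (q%:Z - N%:Z)%R)%g.
Proof.
elim: s N p q a => [|[i b] s IHs] N p q a /=; first by rewrite mulg1.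
have eq0 m : (m%:Z - N%:Z == 0)%R = (m == N) by lia.
rewrite {2}/component_step /= !eq0.
elim/ord3P: i; rewrite ?o01 ?o02 ?o12 ?eqxx; last 2 first.
- by rewrite IHs; case: eqP; rewrite ?mul1g ?mulgA.
- by rewrite IHs; case: eqP; rewrite ?mul1g ?mulgA.
by case: b; rewrite IHs; congr (_ * component s _ _)%g; lia.
Qed.

(** By [component_window] finitely many points decide triviality. At each of them either the
    diagonal is killed, which is semidecidable, or a computable permutation is 1. *)
Lemma lamp_word_problem_re : word_problem_re x.
Proof.
(* [N s] is the radius of the window; adding it turns the coordinates into natural numbers. *)
pose N (s : seq ('I_3 * bool)) := 3 * size s + 2.
pose box s := iota 0 (2 * N s).+1.
pose dead (t : (seq ('I_3 * bool) * nat) * nat) := (t.1.2 <= t.2 /\ K (t.2 - t.1.2)) \/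
  ((foldl component_step (N t.1.1, (t.1.2, (t.2, 1%g))) t.1.1).2.2.2 == 1%g).
apply: (@eq_semidecidable _ _ (fun s => ups o0 s == downs o0 s /\
  forall p, p \in box s -> forall q, q \in box s -> dead ((s, p), q))).
  move=> s; have -> : (eval x s = 1%g) <-> (eval (lamp_gen K) s = 1%g).
    rewrite -(spanned_span_eval (lamp_gen K)); split=> [->|s1]; first exact: spanned1.
    by apply: val_inj; apply: etrans s1 (esym (spanned1 _)).
  rewrite eval_lamp_eq1 height_lamp_eval.
  have deadE p q : dead ((s, p), q) <-> killed K (p%:Z - (N s)%:Z)%R (q%:Z - (N s)%:Z)%R \/
      component s (p%:Z - (N s)%:Z)%R (q%:Z - (N s)%:Z)%R = 1%g.
    rewrite /dead foldl_component_step mul1g /=; split=> -[].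
    - by move=> [pq Kpq]; left; exists (q - p); split=> //; lia.
    - by move=> /eqP; right.
    - move=> [d [e Kd]]; left; have -> : q - p = d by lia.
      by split=> //; lia.
    - by move=> ->; right; rewrite eqxx.
  split=> -[h0 win]; (split; first by lia); last first.
    by move=> p _ q _; apply/deadE.
  apply: component_window => p q pN qN.
  have [p' pE] : exists p' : nat, p = (p'%:Z - (N s)%:Z)%R by exists (absz (p + (N s)%:Z)%R);
    rewrite /N; lia.
  have [q' qE] : exists q' : nat, q = (q'%:Z - (N s)%:Z)%R by exists (absz (q + (N s)%:Z)%R);
    rewrite /N; lia.
  by rewrite pE qE; apply/deadE; apply: win; rewrite mem_iota; rewrite /N in pE qE *; lia.
apply: semidecidable_and.
  by apply: semidecidable_bool; rewrite /ups /downs; computability.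
have cbox (S : Type) (ES : encodable S) (f : S -> seq ('I_3 * bool)) :
    computable f -> computable (fun s => box (f s)).
  by move=> cf; rewrite /box /N; computability.
apply: (semidecidable_all (A := fun s p => forall q, q \in box s -> dead ((s, p), q)) (l := box));
  last by apply: cbox; computability.
apply: (semidecidable_all (A := fun t q => dead (t, q)) (l := fun t => box t.1));
  last by apply: cbox; computability.
apply: semidecidable_or.
  apply: semidecidable_and; first by apply: semidecidable_bool; computability.
  by apply: (semidecidable_comp reK); computability.
apply: semidecidable_bool; rewrite /component_step /N; computability.
  by apply: (computable_fin (fun a => (a * alpha)%g)); computability.
by apply: (computable_fin (fun a => (a * beta)%g)); computability.
Qed.

End LampWordProblem.

(** * Unsolvability of the word problem, and slabs *)

Section LampGroupProperties.
Variable K : nat -> Prop.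
Local Open Scope ring_scope.

Notation G := (gen_group (lamp_gen K)).
Notation x := (span_gen (lamp_gen K)).

Lemma component_up s d p q :
  component (nseq d (o0, false) ++ s) p q = component s (p - d%:Z)%R (q - d%:Z)%R.
Proof.
elim: d p q => [|d IHd] p q; first by rewrite !subr0.
by rewrite /= eqxx IHd; congr component; lia.
Qed.

Lemma component_down s d p q :
  component (nseq d (o0, true) ++ s) p q = component s (p + d%:Z)%R (q + d%:Z)%R.
Proof.
elim: d p q => [|d IHd] p q; first by rewrite !addr0.
by rewrite /= eqxx IHd; congr component; lia.
Qed.

(** The commutator of one involution with the [d]-th conjugate of the other, which for involutions
    is the square of their product. *)
Definition meeting_word (d : nat) : seq ('I_3 * bool) :=
  let v := (o1, false) :: nseq d (o0, false) ++ (o2, false) :: nseq d (o0, true) in v ++ v.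

Lemma component_meeting_word d p q : component (meeting_word d) p q =
  (((if p == 0 then alpha else 1) * (if q == d%:Z then beta else 1)) ^+ 2)%g.
Proof.
have half s : component ((o1, false) :: nseq d (o0, false) ++ (o2, false) :: nseq d (o0,
  true) ++ s) p q =
    ((if p == 0 then alpha else 1) * (if q == d%:Z then beta else 1) * component s p q)%g.
  rewrite /= o01 eqxx component_up /= o02 o12 component_down !subrK mulgA.
  by rewrite subr_eq0.
rewrite /meeting_word -cat_cons -catA cat_cons half -[X in component X]cats0 -catA cat_cons half.
by rewrite expg2 mulg1.
Qed.

Lemma alpha_beta_square : ((alpha * beta) ^+ 2 != 1)%g.
Proof.
have o10 := eq_sym o0 o1; have o20 := eq_sym o0 o2; have o21 := eq_sym o1 o2.
rewrite o01 in o10; rewrite o02 in o20; rewrite o12 in o21.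
apply/eqP => /permP/(_ o0)/eqP; rewrite expg2 !permM perm1 /alpha /beta.
by rewrite !tpermL [tperm o0 o1 o2]tpermD ?o20 ?o21 // tpermR o01.
Qed.

(** Except at [(0, d)] at most one involution is present and squares to 1. At [(0, d)] the value is
    [(alpha * beta) ^+ 2], which disappears exactly when the diagonal [d] is killed. *)
Lemma meeting_word_eval d : eval x (meeting_word d) = 1%g <-> K d.
Proof.
have -> : (eval x (meeting_word d) = 1%g) <-> (eval (lamp_gen K) (meeting_word d) = 1%g).
  rewrite -(spanned_span_eval (lamp_gen K)); split=> [->|s1]; first exact: spanned1.
  by apply: val_inj; apply: etrans s1 (esym (spanned1 _)).
rewrite eval_lamp_eq1; split=> [[_ /(_ 0%R d%:Z)]|Kd].
  rewrite component_meeting_word !eqxx => -[[e [de Ke]]|/eqP]; last first.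
    by rewrite (negbTE alpha_beta_square).
  by have -> : d = e by lia.
split.
  rewrite height_lamp_eval /ups /downs /meeting_word !count_cat /= !count_cat /= !count_nseq.
  by rewrite !xpair_eqE ?o01 ?o02 ?eqxx /=; lia.
move=> p q; rewrite component_meeting_word; have [->|_] := eqVneq p 0%R; last first.
  by right; case: eqP; rewrite mul1g ?expg1n // expg2 tperm2.
have [->|_] := eqVneq q d%:Z; first by left; exists d; rewrite add0r.
by right; rewrite mulg1 expg2 tperm2.
Qed.

Lemma lamp_span_unsolvable : solvable_word_problem G -> computable (fun d => `[<K d>]).
Proof.
case=> l [y [geny /solvable_computable_eval cy]].
have [u uE] := choice (fun i => generating_eval geny (x i)).
have cu := computable_substitute u.
apply: (@eq_computable _ _ _ _ (fun d => `[<eval y (substitute u (meeting_word d)) = 1%g>])).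
  move=> d; rewrite (eval_substitute _ uE); apply: asbool_equiv_eq; exact: meeting_word_eval.
by apply: (computable_comp cy); rewrite /meeting_word; computability.
Qed.

Definition span_height (g : G) : int := height (spanned g).

Lemma span_heightM (g h : G) : span_height (g * h)%g = span_height g + span_height h.
Proof. by rewrite /span_height spannedM. Qed.

Lemma span_height_gen i : span_height (x i) = (i == o0)%:R.
Proof. exact: height_lamp_genE. Qed.

(* The slab consists of the elements whose lamps at [(p, q)] depend only on the
   lamps at [(p, q)] of finitely many conjugates of the generators. *)
Lemma lamp_slab n : exists O : {fset G}, slab x o0 span_height n.+1 (fun g => g \in O).
Proof.
(* The pattern of both involutions along [n.+1] diagonal steps from [(p, q)]; it takes finitely many
   values, so the elements [elt a] are finite in number. *)
pose trace p q : {ffun 'I_n.+1 -> 'S_3 * 'S_3} := [ffun j : 'I_n.+1 =>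
  (lamps (lamp_gen K o1) (p + (j : nat)%:Z) (q + (j : nat)%:Z),
   lamps (lamp_gen K o2) (p + (j : nat)%:Z) (q + (j : nat)%:Z))].
pose elt (a : 'I_n.+1 * {ffun {ffun 'I_n.+1 -> 'S_3 * 'S_3} -> 'S_3}) : lamp :=
  Lamp (a.1 : nat)%:Z (fun p q => a.2 (trace (p - (a.1 : nat)%:Z) (q - (a.1 : nat)%:Z))).
pose D : set G := [set g | exists a, spanned g = elt a]%classic.
have finD : finite_set D.
  have -> : D = (@spanned _ _ (lamp_gen K) @^-1` (elt @` [set: _]))%classic.
    by apply/seteqP; split=> g [a]; [exists a | move=> _ e; exists a].
  by apply: finite_preimage; [move=> g h _ _; apply: val_inj | apply: finite_image;
    apply: finite_finset].
exists (fset_set D); have DE g : (g \in fset_set D) = `[<D g>] by rewrite in_fset_set.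
split.
  exists 1%g; rewrite DE; apply/asboolP; exists (ord0, [ffun=> 1%g]).
  by rewrite spanned1; apply: lamp_eq => //= p q; rewrite ffunE.
move=> g; rewrite DE => /asboolP[[m F] gE].
have hg : span_height g = (m : nat)%:Z by rewrite /span_height gE.
have lg p q : lamps (spanned g) p q = F (trace (p - (m : nat)%:Z) (q - (m : nat)%:Z)) by rewrite
  gE.
(* The generator at [(p, q)] is read off the [m]-th entry of the trace at [(p - m, q - m)], so the
   product is again a function of this trace. *)
have close i (pr : 'S_3 * 'S_3 -> 'S_3) : height (lamp_gen K i) = 0 ->
    (forall p q, lamps (lamp_gen K i) p q = pr (trace (p - (m : nat)%:Z) (q - (m : nat)%:Z) m)) ->
    (x i * g)%g \in fset_set D.
  move=> i0 prE; rewrite DE; apply/asboolP;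
    exists (m, [ffun s : {ffun 'I_n.+1 -> 'S_3 * 'S_3} => (pr (s m) * F s)%g]).
  rewrite spannedM; apply: lamp_eq => [|p q] /=; first by rewrite -/(span_height g) hg i0 add0r.
  by rewrite ffunE -prE -lg i0 !subr0.
split.
- by rewrite hg; have := ltn_ord m; lia.
- elim/ord3P; rewrite ?eqxx // => _.
    by apply: (close _ fst) => [|p q]; rewrite ?height_lamp_genE ?o01 // ffunE /= !subrK.
  by apply: (close _ snd) => [|p q]; rewrite ?height_lamp_genE ?o02 // ffunE /= !subrK.
(* The shift moves the height and the base point of the trace together, hence [F] is unchanged. *)
- rewrite hg => mn; have mn' : (m.+1 < n.+1)%N by lia.
  rewrite DE; apply/asboolP; exists (Ordinal mn', F); rewrite spannedM.
  apply: lamp_eq => [|p q]; rewrite /= /lamp_gen eqxx /=.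
    by rewrite -/(span_height g) hg; lia.
  by rewrite mul1g lg; congr (F (trace _ _)); lia.
- rewrite hg => m0; have mn' : (m.-1 < n.+1)%N by have := ltn_ord m; lia.
  rewrite DE; apply/asboolP; exists (Ordinal mn', F); rewrite spannedM spannedV.
  apply: lamp_eq => [|p q]; rewrite /= /lamp_gen eqxx /=.
    by rewrite -/(span_height g) hg; lia.
  by rewrite invg1 mul1g lg; congr (F (trace _ _)); lia.
Qed.

End LampGroupProperties.

Lemma lamp_span_C_CF (K : nat -> Prop) : semidecidable K -> C_CF (gen_group (lamp_gen K)).
Proof.
move=> reK; pose x := span_gen (lamp_gen K).
have genx : generating x := span_generating (@lamp_gen_inj K).
have rex : word_problem_re x := lamp_word_problem_re reK.
have heightM := @span_heightM K; have heightG := @span_height_gen K.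
have slabs := @lamp_slab K.
split; last by exists 3, x; split=> //; apply: (slab_computable_folner heightM heightG).
split; first by exists 3, x.
  exists 3, x; split=> //; apply: (word_problem_re_recursively_presentable (i := o1)) => //.
  apply: val_inj; apply: etrans (spannedM _ _) (etrans _ (esym (spanned1 _))).
  apply: lamp_eq => [|p q].
    by rewrite /= /lamp_gen o01 eqxx.
  by rewrite /= /lamp_gen o01 eqxx /= !subr0; case: ifP => _; rewrite ?mul1g ?tperm2.
exists 3, x; split=> // -[//|n] _; have [O OP] := slabs n.
by exists O; apply: (slab_folner heightM heightG).
Qed.

Theorem theorem3 :
  class_eq C_CFI C_WP /\
  class_proper C_WP C_CF /\
  class_sub C_CF C_SF /\
  class_eq C_SF C_CR /\
  class_eq C_CR C_A.
Proof.
(* Presentation and amenability may be given for different generators; both are expressed in those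
   of the presentation. *)
have common G : C_A G -> exists k (x : 'I_k -> G),
    [/\ generating x, word_problem_re x & amenable_wrt x].
  move=> [_ [k [x [genx /recursive_presentation_re rex]]] [l [y [geny amy]]]].
  by exists k, x; split=> //; apply: amenable_generators amy.
have SF G : C_A G -> C_SF G.
  move=> AG; split=> //; have [k [x [genx rex amx]]] := common G AG.
  by exists k, x; split=> //; apply: amenable_subrecursive_folner.
have CR G : C_A G -> C_CR G.
  move=> AG; split=> //; have [k [x [genx rex amx]]] := common G AG.
  by exists k, x; split=> //; apply: amenable_computable_reiter.
have CFI G : C_WP G -> C_CFI G.
  move=> [AG [k [x [genx wpx]]]]; split=> //; have [_ _ [l [y [geny amy]]]] := AG.
  exists k, x; split=> //; apply: solvable_computable_folner_injective => //.
  exact: amenable_generators amy.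
split; [|split; [split|split; [|split]]].
- move=> G; split=> [[AG [l [y [geny cfy]]]]|]; last exact: CFI.
  split=> //; have [k [x [genx rex _]]] := common G AG.
  (* The word problem is solved over the generators of the Folner algorithm, to which
     semidecidability is transferred. *)
  exists l, y; split=> //; apply: computable_folner_injective_solvable cfy.
  exact: word_problem_re_generators rex.
- move=> G /CFI[AG [k [x [genx [c cP]]]]]; split=> //; exists k, x; split=> //.
  by exists c => n /cP[F [? ? _]]; exists F.
- exists (gen_group (lamp_gen self_halting)); split.
    exact: lamp_span_C_CF semidecidable_self_halting.
  by move=> [_ /lamp_span_unsolvable]; apply: self_halting_undecidable.
- by move=> G [/SF].
- by move=> G; split=> [[/CR]|[/SF]].
- by move=> G; split=> [[]|/CR].
Qed.
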